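(* Let $\mathbf{X}$ be an exchangeable random vector in $\mathbb{R}^n$ with $\mathbb{E}[X_k^2]<\infty$ for all $k\in[n]$, and let $\mathbf{Y}$ satisfy $\mathbf{Y}|\mathbf{X}=\mathbf{x}\sim\mathcal{N}(\mathbf{x},\sigma^2\mathbf{I}_n)$ with $\sigma>0$. Define $$g(\mathbf{y})=\mathbb{P}[\mathbf{X}\in\vec{\mathbb{R}}_n|\mathbf{Y}=\mathbf{y}]\left(1-\mathbb{P}[\mathbf{X}\in\vec{\mathbb{R}}_n|\mathbf{Y}=\mathbf{y}]\right)$$ and $$\Delta_{\mathrm{up}}=\sum_{\pi\in\mathcal{P}}\mathbb{E}\left[\|\mathbf{X}\|^2 g(\mathbf{P}_\pi\mathbf{Y})\,\middle|\,\mathbf{Y}\in\vec{\mathbb{R}}_n\right]$$ (which depends on $\sigma$). Then $$\lim_{\sigma\to 0}\Delta_{\mathrm{up}}=0,\qquad \lim_{\sigma\to\infty}\Delta_{\mathrm{up}}=\mathbb{E}[\|\mathbf{X}\|^2]\left(1-\frac{1}{n!}\right).$$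
   Context: $\vec{\mathbb{R}}_n$ is the set of vectors in $\mathbb{R}^n$ whose entries are in ascending order. $[n]=\{1,\dots,n\}$; $\mathcal{P}$ is the set of permutations of $[n]$ and $\mathbf{P}_\pi$ the permutation matrix of $\pi$. A random vector is exchangeable if its distribution is invariant under every permutation of its coordinates.
   Formalization: For both limits the theorem also assumes that X has no ties, P[X_i = X_j] = 0 for i ≠ j; without this the limit as σ→∞ is false (n = 2, X = (c,c), c ≠ 0 gives Δ_up = 0 for every σ, but the claimed limit is c²). *)

(* Defs.v *)
From HB Require Import structures.
From mathcomp Require Import all_boot all_order all_algebra all_fingroup.
From mathcomp Require Import all_classical all_reals all_analysis.
Set Implicit Arguments. Unset Strict Implicit. Unset Printing Implicit Defensive.
Import numFieldNormedType.Exports.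
Import Order.TTheory GRing.Theory Num.Theory.
Local Open Scope classical_set_scope.
Local Open Scope ring_scope.

Section Defs.
Context {R : realType} {n : nat}.

Definition permvec (pi : 'S_n) (x : n.-tuple R) : n.-tuple R :=
  [tuple tnth x (pi i) | i < n].

Definition ascending : set (n.-tuple R) :=
  [set x | forall i j : 'I_n, (i <= j)%N -> tnth x i <= tnth x j].

Definition sqnorm (x : n.-tuple R) : R := \sum_(i < n) tnth x i ^+ 2.

End Defs.

Definition exchangeable d (T : measurableType d) (R : realType)
  (P : probability T R) n (X : T -> n.-tuple R) : Prop :=
  forall (pi : 'S_n) (A : set (n.-tuple R)), measurable A ->
    P (X @^-1` A) = P ((permvec pi \o X) @^-1` A).

(* Y | X = x ~ N(x, sigma^2 I_n): the conditional law of Y given X is the product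
   of the one-dimensional normals N(x_i, sigma^2), stated on measurable rectangles
   (which generate the product sigma-algebra of n.-tuple R) *)
Definition cond_gaussian d (T : measurableType d) (R : realType)
  (P : probability T R) n (X Y : T -> n.-tuple R) (sigma : R) : Prop :=
  forall (A : set (n.-tuple R)) (B : 'I_n -> set R),
    measurable A -> (forall i, measurable (B i)) ->
    P (X @^-1` A `&` [set w | forall i, B i (tnth (Y w) i)]) =
    (\int[P]_(w in X @^-1` A) \prod_(i < n) normal_prob (tnth (X w) i) sigma (B i))%E.

Definition cond_prob_version d (T : measurableType d) (R : realType)
  (P : probability T R) n (X Y : T -> n.-tuple R) (S : set (n.-tuple R))
  (h : n.-tuple R -> R) : Prop :=
  measurable_fun setT h /\
  forall B : set (n.-tuple R), measurable B ->
    P (X @^-1` S `&` Y @^-1` B) = (\int[P]_(w in Y @^-1` B) (h (Y w))%:E)%E.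

Definition cond_expect_event d (T : measurableType d) (R : realType)
  (P : probability T R) (W : T -> R) (E : set T) : R :=
  Rintegral P E W / fine (P E).

(* Main.v *)
Require Import Defs.
From HB Require Import structures.
From mathcomp Require Import all_boot all_order all_algebra all_fingroup.
From mathcomp Require Import all_classical all_reals all_analysis.
From mathcomp Require Import measurable_realfun ring lra.
Import numFieldNormedType.Exports.
Import Order.TTheory GRing.Theory Num.Theory.
Local Open Scope classical_set_scope.
Local Open Scope ring_scope.
Set Implicit Arguments. Unset Strict Implicit. Unset Printing Implicit Defensive.

(** Since [(X, Y)] is jointly exchangeable and [Y] has no ties almost surely,
    exactly one of the permuted vectors [permvec pi Y] is ascending. Hence
    [P (Y ascending) = 1 / n!] and, moving the permutations from [g] to the
    conditioning event, [Delta_up = n! * E (|X|^2 g(Y))]. The pair [(X, Y)] has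
    the law of [(X, X + sigma Z)] with [Z] standard normal independent of [X].

    Write [h] for the posterior probability of [X] being ascending, and
    [g = h (1 - h)]. Integrability of [|X|^2] reduces both limits to the
    convergence in [L1] of a [[0, 1]]-valued variable.
    - [sigma -> 0]: [E g(Y)] is at most the probability that exactly one of
      [X] and [Y] is ascending, which tends to [0] by dominated convergence.
    - [sigma -> oo]: on [|X|^2 <= M], the law of [Y] given [X] is bounded by a
      constant close to [1] times the law of [t Z], where [t = sigma + 1].
      Applied to an event and to its complement, this makes [X] and [Y] nearly
      independent, so [h(Y)] tends to [p = 1 / n!] in [L1]; conclude with
      [|h (1 - h) - p (1 - p)| <= |h - p|]. *)

(** * One-dimensional normal laws: affine images and domination *)

(** Packages an image law as a [probability], so that uniqueness theorems for measures apply to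
    it. *)
Lemma pushforward_probability d1 d2 (T1 : measurableType d1)
    (T2 : measurableType d2) (R : realType) (mu : probability T1 R)
    (f : T1 -> T2) :
  measurable_fun setT f ->
  exists nu : probability T2 R, forall A, nu A = mu (f @^-1` A).
Proof.
move=> mf.
pose F : {mfun T1 >-> T2} := HB.pack f (isMeasurableFun.Build _ _ _ _ f mf).
by exists (distribution mu F).
Qed.

(** Both sides are finite measures in [B]. They agree on the half-lines [[c, +oo[], an
    intersection-stable generator of the Borel sets, by the substitution [x = m + s * z] in the
    integral of the density. *)
Lemma normal_prob_affine (R : realType) (m s : R) (B : set R) :
  0 < s -> measurable B ->
  normal_prob m s B = normal_prob 0 1 [set z | B (m + s * z)].
Proof.
move=> s0 mB.
have mF : measurable_fun setT (fun z : R => m + s * z).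
  by apply: measurable_funD => //; exact: measurable_funM.
have [nu nuE] := @pushforward_probability _ _ (measurableTypeR R)
  (measurableTypeR R) R (normal_prob 0 1) _ mF.
rewrite -[RHS]nuE.
apply: (@measure_unique _ R (measurableTypeR R) (@RGenCInfty.G R)
  (fun k => `[- k%:R, +oo[%classic)) => //.
- exact: RGenCInfty.measurableE.
- move=> _ _ [x ->] [y ->]; exists (Num.max x y).
  by apply/seteqP; split=> z /=; rewrite !in_itv/= !andbT ge_max => /andP.
- by move=> k; exists (- k%:R).
- apply/seteqP; split => // x _ /=; exists (Num.trunc `|x|).+1 => //=.
  rewrite in_itv/= andbT lerNl (le_trans (ler_norm _))// normrN.
  exact/ltW/truncnS_gt.
- move=> _ [c ->]; transitivity (nu `[c, +oo[%classic) => //.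
  rewrite nuE /= [LHS]/normal_prob.
  pose F z : R := m + s * z.
  have dF (x : R) : is_derive x 1 F s.
    have : is_derive x 1 F (0 + (s *: 1 + x *: 0)).
      apply: is_deriveD; apply: is_deriveM.
    by rewrite scaler0 addr0 add0r /GRing.scale/= mulr1.
  have DF : F^`()%classic = cst s.
    by apply/funext => x; rewrite derive1E derive_val.
  rewrite [in LHS](_ : c = F ((c - m) / s)); last first.
    by rewrite /F mulrC divfK ?gt_eqF//; lra.
  have s_neq0 : s != 0 by rewrite gt_eqF.
  rewrite increasing_ge0_integration_by_substitutiony.
  + rewrite /normal_prob; rewrite [X in _ = integral _ X _](_ : _ = `[(c - m) /
      s, +oo[%classic); last first.
      by apply/seteqP; split=> z /=; rewrite !in_itv/= !andbT ler_pdivrMr//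
        lerBlDl (mulrC z).
    apply: eq_integral => z _; congr (_%:E) => /=.
    rewrite DF /= !fctE !normal_pdfE ?oner_neq0//.
    rewrite /normal_peak /normal_fun /F /= !expr1n mul1r.
    rewrite -mulrnAr sqrtrM ?sqr_ge0// sqrtr_sqr gtr0_norm// invfM.
    rewrite (_ : (m + s * z - m) = s * z); last by lra.
    rewrite (_ : - (s * z) ^+ 2 / (s ^+ 2 *+ 2) = - (z - 0) ^+ 2 / (1 *+ 2));
      last first.
      by rewrite -(mulr_natr (s ^+ 2)); field.
    by rewrite -!mulrA mulrC -!mulrA divff// mulr1.
  + by move=> x y _ _ xy; rewrite /F ltrD2l ltr_pM2l.
  + by rewrite DF => ? _; exact: cvg_cst.
  + by rewrite DF; exact: is_cvg_cst.
  + by rewrite DF; exact: is_cvg_cst.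
  + split.
      by move=> x _; have [] := dF x.
    apply: cvg_at_right_filter.
    by apply: differentiable_continuous; apply/derivable1_diffP; have [] := dF
      ((c - m) / s).
  + rewrite (_ : F = (fun y => y + m) \o (fun z => s * z)); last first.
      by apply/funext => z; rewrite /F /= addrC.
    by apply: cvg_comp (cvg_addrr m); apply: gt0_cvgMry => //; exact: cvg_id.
  + by apply: continuous_subspaceT; exact: continuous_normal_pdf.
  + by move=> x _; exact: normal_pdf_ge0.
- by move=> k; exact: le_lt_trans (probability_le1 _ _) (ltry _).
Qed.

(** The inequality already holds between densities. Their ratio is [t / s] times the exponential of
    [x ^+ 2 / (2 * t ^+ 2) - (x - m) ^+ 2 / (2 * s ^+ 2)], a quadratic in [x] that is bounded above
    because [s < t]. *)
Lemma normal_prob_le (R : realType) (m s t : R) (B : set R) :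
  0 < s -> s < t -> measurable B ->
  (normal_prob m s B <=
   (t / s * expR (m ^+ 2 / (2 * (t ^+ 2 - s ^+ 2))))%:E * normal_prob 0 t B)%E.
Proof.
move=> s0 st mB; have t0 : 0 < t by exact: lt_trans st.
rewrite /normal_prob -ge0_integralZl//; last 3 first.
- by apply/measurable_EFinP; apply: measurable_funTS; exact:
    measurable_normal_pdf.
- by move=> x _; rewrite lee_fin normal_pdf_ge0.
- by rewrite lee_fin mulr_ge0 ?expR_ge0// divr_ge0// ltW.
apply: ge0_le_integral => //.
- by move=> x _; rewrite lee_fin normal_pdf_ge0.
- by apply/measurable_EFinP; apply: measurable_funTS; exact:
    measurable_normal_pdf.
- apply/measurable_EFinP; apply: measurable_funTS; apply: measurable_funM => //.
  exact: measurable_normal_pdf.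
move=> x _; rewrite -EFinM lee_fin !normal_pdfE ?gt_eqF//.
rewrite /normal_peak /normal_fun /=.
rewrite -(mulrnAr (s ^+ 2)) -(mulrnAr (t ^+ 2)) (sqrtrM _ (sqr_ge0 s)) (sqrtrM _
  (sqr_ge0 t)) !sqrtr_sqr.
rewrite !gtr0_norm// !(invfM _ (Num.sqrt (pi *+ 2))).
set a := (Num.sqrt _)^-1; have a0 : 0 <= a by rewrite invr_ge0 sqrtr_ge0.
have -> : t / s * expR (m ^+ 2 / (2 * (t ^+ 2 - s ^+ 2))) *
    (t^-1 * a * expR (- (x - 0) ^+ 2 / (t ^+ 2 *+ 2))) =
    s^-1 * a * (expR (m ^+ 2 / (2 * (t ^+ 2 - s ^+ 2))) * expR (- (x - 0) ^+ 2 /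
      (t ^+ 2 *+ 2))).
  by field; rewrite !gt_eqF.
rewrite ler_wpM2l ?mulr_ge0 ?invr_ge0 ?(ltW s0)// -expRD ler_expR.
have ts : 0 < t ^+ 2 - s ^+ 2 by rewrite subr_gt0 ltr_pXn2r ?nnegrE ?ltW.
rewrite -subr_ge0.
(* Completing the square: the gap between the exponents vanishes exactly at
   [x = t ^+ 2 * m / (t ^+ 2 - s ^+ 2)], which is where the constant comes from. *)
rewrite (_ : _ - _ = ((t ^+ 2 - s ^+ 2) * x - t ^+ 2 * m) ^+ 2 /
    (2 * s ^+ 2 * t ^+ 2 * (t ^+ 2 - s ^+ 2))).
  by rewrite divr_ge0 ?sqr_ge0 ?mulr_ge0 ?sqr_ge0// ltW.
by field; rewrite !gt_eqF.
Qed.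

(** * Standard Gaussian vectors and their shifts *)

Definition add_scaled (R : realType) n (x : n.-tuple R) (s : R) (z : n.-tuple R)
  :
    n.-tuple R :=
  [tuple tnth x i + s * tnth z i | i < n].

Lemma measurable_add_scaled (R : realType) n (x : n.-tuple R) (s : R) :
  measurable_fun setT (add_scaled x s).
Proof.
apply/measurable_fun_tnthP => i.
rewrite (_ : _ \o _ = fun z => tnth x i + s * tnth z i); last first.
  by apply/funext => z /=; rewrite tnth_mktuple.
by apply: measurable_funD => //; apply: measurable_funM => //; exact:
  measurable_tnth.
Qed.

Lemma add_scaled_cons (R : realType) n (x : n.+1.-tuple R) (s : R) (z0 : R)
    (z : n.-tuple R) :
  add_scaled x s [tuple of z0 :: z] =
  [tuple of thead x + s * z0 :: add_scaled (behead_tuple x) s z].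
Proof.
apply: eq_from_tnth => i; rewrite tnth_mktuple.
have [j ->|->] := unliftP ord0 i; last by rewrite !tnth0.
rewrite !tnthS tnth_mktuple; congr (_ + _).
by rewrite [x in LHS]tuple_eta tnthS.
Qed.

Lemma measurable_rect (R : realType) n (B : 'I_n -> set R) :
  (forall i, measurable (B i)) ->
  measurable [set z : n.-tuple R | forall i, B i (tnth z i)].
Proof.
move=> mB; rewrite (_ : [set _ | _] = \bigcap_(i in [set: 'I_n]) ((fun z => tnth
  z i) @^-1` B i)).
  apply: fin_bigcap_measurable => // i _; rewrite -[X in measurable X]setTI.
  exact: measurable_tnth.
by apply/seteqP; split => z zB i; [move=> _|]; exact: zB.
Qed.

(** Tonelli for indicators: [\x] integrates sections over the first factor, and uniqueness of the
    product measure allows slicing along the second factor instead. *)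
Lemma product_measure1E2 d1 d2 (T1 : measurableType d1) (T2 : measurableType d2)
    (R : realType) (m1 : probability T1 R) (m2 : probability T2 R)
    (A : set (T1 * T2)) :
  measurable A -> (m1 \x m2)%E A = (\int[m2]_y m1 (ysection A y))%E.
Proof.
move=> mA; apply: (@product_measure_unique _ _ _ _ _ m1 m2 (m1 \x^ m2)%E) => //.
by move=> B C mB mC; exact: product_measure2E.
Qed.

Lemma sqnorm_cons (R : realType) n (x : n.+1.-tuple R) :
  sqnorm x = sqnorm (behead_tuple x) + thead x ^+ 2.
Proof.
rewrite /sqnorm big_ord_recl addrC; congr (_ + _ ^+ 2).
by apply: eq_bigr => i _; rewrite [x in LHS]tuple_eta tnthS.
Qed.

Section iid_normal.
Variable R : realType.
Local Notation N01 := (normal_prob (0 : R) 1).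

(** Stated on rectangles, in the same form as [cond_gaussian], so that the two can be compared
    directly. *)
Definition iid_normal n (mu : probability (n.-tuple R) R) :=
  forall B : 'I_n -> set R, (forall i, measurable (B i)) ->
    mu [set z | forall i, B i (tnth z i)] = (\prod_(i < n) N01 (B i))%E.

(** The constant is the supremum of the ratio of the densities of
    [x + s Z] and [t Z]. *)
Definition shift_dominated n (mu : probability (n.-tuple R) R) :=
  forall (x : n.-tuple R) (s t : R) (B : set (n.-tuple R)), 0 < s -> s < t ->
    measurable B ->
    (mu (add_scaled x s @^-1` B) <=
     ((t / s) ^+ n * expR (sqnorm x / (2 * (t ^+ 2 - s ^+ 2))))%:E *
     mu (add_scaled (nseq_tuple n 0%R) t @^-1` B))%E.

(** Induction on [n], with the image of [N01 \x mu] under cons as the next measure. For the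
    domination, the coordinates are replaced one at a time: the tail by the induction hypothesis,
    the head by [normal_prob_le]. The constants multiply because [sqnorm] is additive over
    coordinates. *)
Lemma exists_iid_normal n :
  exists mu : probability (n.-tuple R) R, iid_normal mu /\ shift_dominated mu.
Proof.
elim: n => [|n [mu [muE muS]]].
  exists (dirac [tuple] : probability (0.-tuple R) R); split.
    by move=> B mB; rewrite big_ord0 /= diracE mem_set// => -[].
  move=> x s t B s0 st mB; rewrite expr0 mul1r /sqnorm big_ord0 mul0r expR0
    mul1e.
  rewrite (_ : add_scaled x s = add_scaled (nseq_tuple 0 0) t)//.
  by apply/funext => z; rewrite [LHS]tuple0 [RHS]tuple0.
have mcons : measurable_fun setT (fun p : R * n.-tuple R => [tuple of p.1 ::
  p.2]).
  exact: measurable_cons.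
have [nu nuE] := pushforward_probability (N01 \x mu)%E mcons.
have mpre (D : set (n.+1.-tuple R)) : measurable D ->
    measurable ((fun p : R * n.-tuple R => [tuple of p.1 :: p.2]) @^-1` D).
  by move=> mD; rewrite -[X in measurable X]setTI; exact: mcons.
exists nu; split.
  move=> B mB; rewrite nuE big_ord_recl -muE//.
  rewrite -product_measure1E//; [|exact: mB|exact: (measurable_rect (B := fun i
    => B (lift ord0 i)))].
  congr ((_ \x _)%E _); apply/seteqP; split=> -[z0 z] /=.
    by move=> zB; split=> [|i]; [have := zB ord0|have := zB (lift ord0 i)];
      rewrite ?tnth0// tnthS.
  move=> [B0 zB] i; have [j ->|->] := unliftP ord0 i; last by rewrite tnth0.
  by rewrite tnthS.
move=> x s t B s0 st mB; rewrite !nuE.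
pose x' := behead_tuple x; pose z' := nseq_tuple n (0 : R).
pose u := thead x.
pose D f0 (f : n.-tuple R -> n.-tuple R) :=
  [set p : R * n.-tuple R | B [tuple of f0 p.1 :: f p.2]].
have mD f0 f : measurable_fun setT f0 -> measurable_fun setT f -> measurable (D
  f0 f).
  move=> mf0 mf; rewrite -[X in measurable X]setTI.
  apply: (measurable_cons (f := f0 \o fst) (g := f \o snd)) => //;
    exact: measurableT_comp.
have maff a b : measurable_fun setT (fun z : R => a + b * z).
  by apply: measurable_funD => //; exact: measurable_funM.
have mcl a : measurable [set z : n.-tuple R | B [tuple of a :: z]].
  rewrite -[X in measurable X]setTI.
  exact: (measurable_cons (f := cst a) (g := id)).
have mcr (z : n.-tuple R) : measurable [set a : R | B [tuple of a :: z]].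
  rewrite -[X in measurable X]setTI.
  exact: (measurable_cons (f := id) (g := cst z)).
rewrite (_ : _ @^-1` _ = D (fun a => u + s * a) (add_scaled x' s)); last first.
  by apply/funext => -[a z]; rewrite /= add_scaled_cons.
rewrite [in X in (_ <= X)%E](_ : _ @^-1` _ = D (fun a => 0 + t * a) (add_scaled
  z' t)); last first.
  apply/funext => -[a z]; rewrite /= add_scaled_cons.
  by congr (B [tuple of _ :: _]); congr add_scaled; apply: val_inj.
set C := (t / s) ^+ n * expR (sqnorm x' / (2 * (t ^+ 2 - s ^+ 2))).
set c := t / s * expR (u ^+ 2 / (2 * (t ^+ 2 - s ^+ 2))).
have C0 : 0 <= C by rewrite mulr_ge0 ?expR_ge0// exprn_ge0// divr_ge0 ?ltW//
  (lt_trans s0).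
have c0 : 0 <= c by rewrite mulr_ge0 ?expR_ge0// divr_ge0 ?ltW// (lt_trans s0).
have -> : (t / s) ^+ n.+1 * expR (sqnorm x / (2 * (t ^+ 2 - s ^+ 2))) = C * c.
  rewrite /C /c mulrACA -(exprSr (t / s)) -expRD -(mulrDl (sqnorm x')).
  by rewrite (sqnorm_cons x).
rewrite EFinM -muleA.
(* The intermediate law keeps the head [u + s * a] but already has the centred tail of scale [t].
   This first comparison fixes the head and uses the induction hypothesis on the sections. *)
apply: (@le_trans _ _ (C%:E * (N01 \x mu)%E (D (fun a => u + s * a)%R
  (add_scaled z' t)))%E).
  rewrite /product_measure1 -ge0_integralZl//; last first.
    apply: measurable_fun_xsection; apply: mD => //.
    exact: measurable_add_scaled.
  apply: ge0_le_integral => //.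
  - apply: measurable_fun_xsection; apply: mD => //.
    exact: measurable_add_scaled.
  - apply: measurable_funeM; apply: measurable_fun_xsection; apply: mD => //.
    exact: measurable_add_scaled.
  move=> a _ /=; have := muS x' s t _ s0 st (mcl (u + s * a)).
  rewrite (_ : xsection _ _ = add_scaled x' s @^-1` [set z : n.-tuple R | B
    [tuple of u + s * a :: z]]); last first.
    by apply/funext => z; rewrite /xsection/= asboolE.
  rewrite (_ : xsection _ _ = add_scaled z' t @^-1` [set z : n.-tuple R | B
    [tuple of u + s * a :: z]]); last first.
    by apply/funext => z; rewrite /xsection/= asboolE.
  exact.
apply: lee_wpmul2l; first by rewrite lee_fin.
(* The second comparison changes the head with the tail fixed, hence the other order of
   integration. *)
rewrite (product_measure1E2 N01 mu (mD _ _ (maff u s) (measurable_add_scaled z'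
  t))).
rewrite [X in (_ <= _ * X)%E](product_measure1E2 N01 mu (mD _ _ (maff 0 t)
  (measurable_add_scaled z' t))).
rewrite -ge0_integralZl//; last first.
  by apply: measurable_fun_ysection; apply: mD => //; exact:
    measurable_add_scaled.
apply: ge0_le_integral => //.
- by apply: measurable_fun_ysection; apply: mD => //; exact:
    measurable_add_scaled.
- apply: measurable_funeM; apply: measurable_fun_ysection; apply: mD => //.
  exact: measurable_add_scaled.
move=> z _ /=.
have := normal_prob_le u s0 st (mcr (add_scaled z' t z)).
rewrite (normal_prob_affine u s0 (mcr _)) (normal_prob_affine 0 (lt_trans s0 st)
  (mcr _)) => h.
rewrite (_ : ysection _ _ = [set a | [set a : R | B [tuple of a :: add_scaled z'
  t z]] (u + s * a)]); last first.
  by apply/funext => a; rewrite /ysection/= asboolE.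
rewrite (_ : ysection _ _ = [set a | [set a : R | B [tuple of a :: add_scaled z'
  t z]] (0 + t * a)]); last first.
  by apply/funext => a; rewrite /ysection/= asboolE.
exact: h.
Qed.

End iid_normal.

(** * The joint law of [X] and [Y] as signal plus independent noise *)

(** The sets in the hypothesis are stable under intersection and generate the product sigma-algebra,
    so uniqueness of measures applies. It turns the rectangle form of [cond_gaussian] into a
    statement about all events. *)
Lemma measure_eq_rect (R : realType) n (m1 m2 : probability (n.-tuple R *
  n.-tuple R)%type R) :
  (forall (A : set (n.-tuple R)) (B : 'I_n -> set R),
     measurable A -> (forall i, measurable (B i)) ->
     m1 (A `*` [set y | forall i, B i (tnth y i)]) =
     m2 (A `*` [set y | forall i, B i (tnth y i)])) ->
  forall C, measurable C -> m1 C = m2 C.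
Proof.
move=> m12 C mC.
pose G := [set D : set (n.-tuple R * n.-tuple R) | exists (A : set (n.-tuple R))
  (B : 'I_n -> set R),
  [/\ measurable A, forall i, measurable (B i) & D = A `*` [set y | forall i, B
    i (tnth y i)]]].
have GT : G setT.
  exists setT, (fun=> setT); split => //.
  by apply/seteqP; split.
apply: (measure_unique G (fun=> setT)) => //.
- apply/seteqP; split.
    (* Generation: for the sigma-algebra generated by [G], both projections are measurable, hence so
       is the identity into the product space. *)
    pose S := g_sigma_algebraType G.
    have mfst : @measurable_fun _ _ S (n.-tuple R) setT fst.
      move=> _ A mA; rewrite setTI; apply: sub_sigma_algebra.
      exists A, (fun=> setT); split => //.
      by apply/seteqP; split => -[x y] //= [].
    have msnd : @measurable_fun _ _ S (n.-tuple R) setT snd.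
      apply/measurable_fun_tnthP => i _ A mA; rewrite setTI; apply:
        sub_sigma_algebra.
      exists setT, (fun j => if j == i then A else setT); split => //.
        by move=> j; case: ifP.
      apply/seteqP; split => -[x y] /=.
        by move=> Ay; split => // j; case: eqP => // ->.
      by move=> [_ /(_ i)]; rewrite eqxx.
    have mid : @measurable_fun _ _ S (n.-tuple R * n.-tuple R)%type setT id.
      exact/measurable_fun_pairP.
    by move=> D mD; have := mid measurableT D mD; rewrite setTI.
  apply: smallest_sub; first exact: sigma_algebra_measurable.
  move=> _ [A [B [mA mB ->]]]; apply: measurableX => //.
  exact: measurable_rect.
- move=> _ _ [A [B [mA mB ->]]] [A' [B' [mA' mB' ->]]].
  exists (A `&` A'), (fun i => B i `&` B' i); split.
  + exact: measurableI.
  + by move=> i; exact: measurableI.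
  + apply/seteqP; split => -[x y] /=.
      by move=> [[Ax By] [Ax' By']]; split.
    by move=> [[Ax Ax'] BB']; split; split => // i; have [] := BB' i.
- by rewrite bigcup_const//; exists 0%N.
- by move=> _ [A [B [mA mB ->]]]; exact: m12.
- by move=> k; exact: le_lt_trans (probability_le1 _ _) (ltry _).
Qed.

Section coupling.
Context d (T : measurableType d) (R : realType) (P : probability T R) (n : nat).
Variables (X Y : T -> n.-tuple R) (s : R).
Hypotheses (s0 : 0 < s) (mX : measurable_fun setT X) (mY : measurable_fun setT
  Y).
Hypothesis XY : cond_gaussian P X Y s.
Variable mu : probability (n.-tuple R) R.
Hypothesis iid : iid_normal mu.

Let coupled (p : T * n.-tuple R) := (X p.1, add_scaled (X p.1) s p.2).

Lemma measurable_coupled : measurable_fun setT coupled.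
Proof.
have mXf : measurable_fun setT (fun p : T * n.-tuple R => X p.1).
  exact: measurableT_comp.
apply: measurable_fun_pair => //; apply/measurable_fun_tnthP => i.
rewrite (_ : _ \o _ = fun p : T * n.-tuple R => tnth (X p.1) i + s * tnth p.2
  i); last first.
  by apply/funext => z /=; rewrite tnth_mktuple.
apply: measurable_funD; first exact: (measurableT_comp (measurable_tnth i)).
by apply: measurable_funM => //; exact: (measurableT_comp (measurable_tnth i)).
Qed.

(** The noise lives on an extra factor, so it is independent of [X] by construction. On rectangles
    both sides reduce to the same integral of products of normal probabilities, by [cond_gaussian]
    on the left, and by [iid_normal] and [normal_prob_affine] on the right. *)
Lemma coupling_law (C : set (n.-tuple R * n.-tuple R)) : measurable C ->
  P [set w | C (X w, Y w)] = (P \x mu)%E [set p | C (X p.1, add_scaled (X p.1) s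
    p.2)].
Proof.
move=> mC.
have [m1 m1E] := pushforward_probability P (measurable_fun_pair mX mY).
have [m2 m2E] := pushforward_probability (P \x mu)%E measurable_coupled.
transitivity (m1 C); first by rewrite m1E.
transitivity (m2 C); last by rewrite m2E.
apply: (@measure_eq_rect _ _ m1 m2) => // A B mA mB.
rewrite m1E m2E.
transitivity (P (X @^-1` A `&` [set w | forall i, B i (tnth (Y w) i)])) => //.
have mR : measurable [set y : n.-tuple R | forall i, B i (tnth y i)] by exact:
  measurable_rect.
have mXA : measurable (X @^-1` A) by rewrite -[X in measurable X]setTI; exact:
  mX.
rewrite XY// /product_measure1.
rewrite integral_mkcond; apply: eq_integral => w _.
rewrite patchE; case: ifPn => [|] wA /=.
  transitivity (mu [set z | forall i, [set z | B i (tnth (X w) i + s * z)] (tnth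
    z i)]).
    rewrite (@iid (fun i => [set z0 | B i (tnth (X w) i + s * z0)])); last
      first.
      move=> i; rewrite -[X in measurable X]setTI.
      have : measurable_fun setT (fun z : R => tnth (X w) i + s * z).
        by apply: measurable_funD => //; exact: measurable_funM.
      exact.
    by apply: eq_bigr => i _; rewrite normal_prob_affine.
  congr (mu _); apply/seteqP; split => z /=; rewrite /xsection/= inE /=.
    by move=> Bz; split; [exact: set_mem|move=> i; rewrite tnth_mktuple].
  by move=> [_ Bz] i; have := Bz i; rewrite tnth_mktuple.
rewrite (_ : xsection _ _ = set0) ?measure0//.
apply/seteqP; split => z //=; rewrite /xsection/= inE /= => -[Aw _].
by move: wA; rewrite notin_setE.
Qed.

(** Extends the conditional law of [Y] given [X] from rectangles to every measurable [B]. *)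
Lemma coupling_integral (A : set (n.-tuple R)) (B : set (n.-tuple R)) :
  measurable A -> measurable B ->
  P (X @^-1` A `&` Y @^-1` B) =
  (\int[P]_(w in X @^-1` A) mu (add_scaled (X w) s @^-1` B))%E.
Proof.
move=> mA mB.
rewrite [LHS](coupling_law (measurableX mA mB)) /product_measure1.
rewrite [RHS]integral_mkcond; apply: eq_integral => w _.
rewrite patchE; case: ifPn => [|] wA /=.
  congr (mu _); apply/seteqP; split => z /=; rewrite /xsection/= inE /=.
    by case.
  by split => //; exact: set_mem.
rewrite (_ : xsection _ _ = set0) ?measure0//.
apply/seteqP; split => z //=; rewrite /xsection/= inE /= => -[Aw _].
by move: wA; rewrite notin_setE.
Qed.

End coupling.

(** Two distinct coordinates have the product law of two standard normals. Each section of the line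
    [p.1 = p.2 + c] is a single point, which a normal law does not charge. *)
Lemma iid_normal_tie (R : realType) n (mu : probability (n.-tuple R) R)
    (i j : 'I_n) (c : R) : iid_normal mu -> i != j ->
  mu [set z | tnth z i = tnth z j + c] = 0%E.
Proof.
move=> iid ij.
have mf : measurable_fun setT (fun z : n.-tuple R => (tnth z i, tnth z j)).
  by apply: measurable_fun_pair; exact: measurable_tnth.
have [nu nuE] := @pushforward_probability _ _ _
  (measurableTypeR R * measurableTypeR R)%type R mu _ mf.
have mD : measurable [set p : R * R | p.1 = p.2 + c].
  rewrite (_ : [set _ | _] = (fun p : R * R => p.1 - p.2 - c) @^-1` [set 0]).
    rewrite -[X in measurable X]setTI.
    have : measurable_fun setT (fun p : R * R => p.1 - p.2 - c).
      by apply: measurable_funB => //; exact: measurable_funB.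
    by apply => //; exact: measurable_set1.
  by apply/seteqP; split => -[u v] /= uv; lra.
rewrite (_ : mu _ = nu [set p | p.1 = p.2 + c]); last by rewrite nuE.
rewrite -(@product_measure_unique _ _ _ _ _ (normal_prob (0 : R) 1) (normal_prob
  (0 : R) 1) nu) => //.
  rewrite product_measure1E2//; apply: integral0_eq => y _.
  rewrite (_ : ysection _ _ = [set y + c]); last first.
    by apply/seteqP; split=> z /=; rewrite /ysection/= inE.
  have /null_content_dominatesP := normal_prob_dominates (0 : R) 1.
  by apply => //; exact: lebesgue_measure_set1.
move=> A B mA mB; rewrite [LHS]nuE.
rewrite (_ : _ @^-1` _ = [set z | forall k, (if k == i then A else if k == j
  then B else setT) (tnth z k)]).
  rewrite (@iid (fun k => if k == i then A else if k == j then B else setT));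
    last by move=> k; case: ifP => // _; case: ifP.
  rewrite (bigD1 i)//= (bigD1 j) 1?eq_sym//= eqxx (negbTE (_ : j != i))
    1?eq_sym// eqxx.
  rewrite big1 ?mule1// => k /andP[/negbTE -> /negbTE ->].
  exact: probability_setT.
apply/seteqP; split => z /=.
  by move=> [Az Bz] k; case: eqP => [->//|_]; case: eqP => [->|].
move=> h; split; first by have := h i; rewrite eqxx.
by have := h j; rewrite eqxx eq_sym (negbTE ij).
Qed.

(** * Permutations of coordinates and the ascending cone *)

Section permvec_theory.
Variables (R : realType) (n : nat).
Implicit Types (x y : n.-tuple R) (p q : 'S_n).

Lemma permvecVK p : cancel (permvec p^-1%g) (permvec p : n.-tuple R -> n.-tuple
  R).
Proof. by move=> x; apply: eq_from_tnth => i; rewrite !tnth_mktuple permK. Qed.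

Lemma measurable_permvec p : measurable_fun setT (permvec p : n.-tuple R ->
  n.-tuple R).
Proof.
apply/measurable_fun_tnthP => i.
rewrite (_ : _ \o _ = fun z => tnth z (p i)); first exact: measurable_tnth.
by apply/funext => z /=; rewrite tnth_mktuple.
Qed.

Lemma sqnorm_permvec p x : sqnorm (permvec p x) = sqnorm x.
Proof.
rewrite /sqnorm [RHS](reindex_inj (@perm_inj _ p)).
by apply: eq_bigr => i _; rewrite tnth_mktuple.
Qed.

Lemma sqnorm_ge0 x : 0 <= sqnorm x.
Proof. by apply: sumr_ge0 => i _; exact: sqr_ge0. Qed.

Lemma measurable_sqnorm : measurable_fun setT (@sqnorm R n).
Proof.
apply: measurable_sum => i; apply: measurable_funX; exact: measurable_tnth.
Qed.

Lemma measurable_ascending : measurable (@ascending R n).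
Proof.
rewrite (_ : ascending = \bigcap_(ij in [set ij : 'I_n * 'I_n | (ij.1 <=
  ij.2)%N])
    [set x : n.-tuple R | tnth x ij.1 <= tnth x ij.2]).
  apply: fin_bigcap_measurable => // -[i j] _ /=.
  rewrite (_ : [set _ | _] = (fun x => tnth x j - tnth x i) @^-1` `[0, +oo[).
    rewrite -[X in measurable X]setTI.
    have : measurable_fun setT (fun x : n.-tuple R => tnth x j - tnth x i).
      by apply: measurable_funB; exact: measurable_tnth.
    by apply => //; exact: measurable_itv.
  by apply/seteqP; split => x /=; rewrite in_itv/= andbT subr_ge0.
apply/seteqP; split => x /= xP; first by move=> [i j] /=; exact: xP.
by move=> i j ij; exact: (xP (i, j)).
Qed.

Lemma ascendingP x : ascending x <-> sorted <=%R x.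
Proof.
split=> [xP|xs i j ij].
  apply/(sortedP 0) => i; rewrite size_tuple => i1n.
  have := xP (Ordinal (ltnW i1n)) (Ordinal i1n) (leqnSn _).
  by rewrite !(tnth_nth 0).
rewrite !(tnth_nth 0).
by apply: (sorted_leq_nth le_trans le_refl) => //; rewrite inE size_tuple.
Qed.

(** Sorting supplies one permutation. Any other sorted rearrangement is the same tuple, and distinct
    entries then force the same permutation. *)
Lemma sum_ascending_permvec x : injective (tnth x) ->
  \sum_(p : 'S_n) \1_ascending (permvec p x) = 1 :> R.
Proof.
move=> xI.
have [p pE] := tuple_permP (permEl (perm_sort <=%R x) : perm_eq (sort_tuple <=%R
  x) x).
have pP : ascending (permvec p x).
  by apply/ascendingP; rewrite /permvec /= -pE; exact: sort_le_sorted.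
rewrite (bigD1 p)//= indicE mem_set// big1 ?addr0// => q qp.
rewrite indicE memNset// => /ascendingP qs; case/negP: qp; apply/eqP.
move/ascendingP: pP => ps.
have pq : perm_eq (permvec q x) (permvec p x).
  by apply: (@perm_trans _ x); [|rewrite perm_sym]; apply/tuple_permP; eexists.
have /val_inj E := le_sorted_eq qs ps pq.
by apply/permP => i; apply: xI; have := congr1 (fun t => tnth t i) E; rewrite
  !tnth_mktuple.
Qed.

End permvec_theory.

(** * Ties, and the probability of being ascending *)

Section exchangeability.
Context d (T : measurableType d) (R : realType) (P : probability T R).

Lemma eq_law_integral d' (S : measurableType d') (U V : T -> S) (F : S -> \bar
  R) :
  measurable_fun setT U -> measurable_fun setT V ->
  (forall A, measurable A -> P (U @^-1` A) = P (V @^-1` A)) ->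
  measurable_fun setT F -> (forall x, 0 <= F x)%E ->
  (\int[P]_w F (U w) = \int[P]_w F (V w))%E.
Proof.
move=> mU mV UV mF F0.
transitivity (\int[pushforward P U]_x F x)%E.
  by rewrite ge0_integral_pushforward.
rewrite (eq_measure_integral (pushforward P V)).
  by rewrite ge0_integral_pushforward.
by move=> A mA _; exact: UV.
Qed.

Variable n : nat.

Lemma measurable_tie (W : T -> n.-tuple R) (i j : 'I_n) : measurable_fun setT W
  ->
  measurable [set w | tnth (W w) i = tnth (W w) j].
Proof.
move=> mW.
rewrite (_ : [set _ | _] = (fun w => tnth (W w) i - tnth (W w) j) @^-1` [set
  0]).
  rewrite -[X in measurable X]setTI.
  have : measurable_fun setT (fun w => tnth (W w) i - tnth (W w) j).
    by apply: measurable_funB; exact: (measurableT_comp (measurable_tnth _)).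
  by apply => //; exact: measurable_set1.
by apply/seteqP; split => w /= ww; lra.
Qed.

Lemma tie_freeE (W : T -> n.-tuple R) :
  [set w | injective (tnth (W w))] =
  \bigcap_(ij in [set ij : 'I_n * 'I_n | ij.1 != ij.2])
    ~` [set w | tnth (W w) ij.1 = tnth (W w) ij.2].
Proof.
apply/seteqP; split => w /= wP; first by move=> [i j] /= ij /wP /eqP;
  exact/negP.
by move=> i j ij; apply/eqP; apply: contrapT => /negP nij; exact: (wP (i, j)).
Qed.

Lemma measurable_tie_free (W : T -> n.-tuple R) : measurable_fun setT W ->
  measurable [set w | injective (tnth (W w))].
Proof.
move=> mW; rewrite tie_freeE; apply: fin_bigcap_measurable => // -[i j] _ /=.
by apply: measurableC; exact: measurable_tie.
Qed.

Lemma tie_negligible (W : T -> n.-tuple R) : measurable_fun setT W ->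
  (forall i j, i != j -> P [set w | tnth (W w) i = tnth (W w) j] = 0%E) ->
  P (~` [set w | injective (tnth (W w))]) = 0%E.
Proof.
move=> mW ties; apply/negligibleP; first by apply: measurableC; exact:
  measurable_tie_free.
rewrite tie_freeE setC_bigcap.
(* The finite union over pairs is recoded as a union over the naturals, to use countable unions of
   negligible sets. *)
have -> : \bigcup_(ij in [set ij : 'I_n * 'I_n | ij.1 != ij.2])
    ~` ~` [set w | tnth (W w) ij.1 = tnth (W w) ij.2] =
    \bigcup_k (if unpickle k is Some ij then
      if (ij : 'I_n * 'I_n).1 != ij.2 then [set w | tnth (W w) ij.1 = tnth (W w)
        ij.2]
      else set0 else set0).
  apply/seteqP; split => w /=.
    move=> [ij /= ijne /contrapT wij].
    by exists (pickle ij) => //; rewrite pickleK ijne.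
  move=> [k _]; case: unpickle => [ij|//]; case: ifP => // ijne wij.
  by exists ij => // nwij; exact: (nwij wij).
apply: negligible_bigcup => k; case: unpickle => [[i j]|]; last exact:
  negligible_set0.
case: ifPn => [ij|_]; last exact: negligible_set0.
by apply/negligibleP; [exact: measurable_tie|exact: ties].
Qed.

(** Outside the null event of a tie, the indicators sum to [1] by [sum_ascending_permvec]. *)
Lemma sum_ascending_integral (W : T -> n.-tuple R) (V : T -> R) :
  measurable_fun setT W -> measurable_fun setT V -> (forall w, 0 <= V w) ->
  (forall i j, i != j -> P [set w | tnth (W w) i = tnth (W w) j] = 0%E) ->
  (\sum_(p : 'S_n) \int[P]_w (\1_ascending (permvec p (W w)) * V w)%:E =
   \int[P]_w (V w)%:E)%E.
Proof.
move=> mW mV V0 ties.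
have mI p : measurable_fun setT (fun w => \1_ascending (permvec p (W w)) * V w :
  R).
  apply: measurable_funM => //.
  apply: (measurableT_comp (f := \1_ascending : _ -> R)).
    by apply: measurable_indic; exact: measurable_ascending.
  apply: (measurableT_comp (f := permvec p)) => //; exact: measurable_permvec.
rewrite -ge0_integral_sum//; last 2 first.
- by move=> p; apply/measurable_EFinP; exact: mI.
- by move=> p w _; rewrite lee_fin mulr_ge0.
apply: ge0_ae_eq_integral => //.
- apply: emeasurable_sum => p; apply/measurable_EFinP; exact: mI.
- exact/measurable_EFinP.
- by move=> w _; apply: sume_ge0 => p _; rewrite lee_fin mulr_ge0.
- by move=> w _; rewrite lee_fin.
exists (~` [set w | injective (tnth (W w))]).
have mTF := measurable_tie_free mW; split; first exact: measurableC.
  exact: tie_negligible.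
move=> w /= wP xI; apply: wP => _.
by rewrite sumEFin -mulr_suml sum_ascending_permvec ?mul1r.
Qed.

(** The case [V = 1] of the previous identity: [n!] equal probabilities with sum [1]. *)
Lemma ascending_probability (W : T -> n.-tuple R) :
  measurable_fun setT W ->
  (forall p, P [set w | ascending (permvec p (W w))] = P (W @^-1` ascending)) ->
  (forall i j, i != j -> P [set w | tnth (W w) i = tnth (W w) j] = 0%E) ->
  P (W @^-1` ascending) = ((n`!%:R)^-1)%:E.
Proof.
move=> mW WP ties.
have /= := sum_ascending_integral mW (measurable_cst (1 : R)) (fun _ => ler01)
  ties.
rewrite integral_cst// mul1e [X in _ = X -> _]probability_setT.
rewrite (eq_bigr (fun=> P (W @^-1` ascending))); last first.
  move=> p _; rewrite -(WP p) -[in RHS](setIT [set _ | _]).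
  rewrite -integral_indic//; last first.
    rewrite -[X in measurable X]setTI.
    have : measurable_fun setT (permvec p \o W).
      by apply: measurableT_comp => //; exact: measurable_permvec.
    by apply => //; exact: measurable_ascending.
  by apply: eq_integral => w _; rewrite mulr1.
have mA : measurable (W @^-1` ascending).
  by rewrite -[X in measurable X]setTI; apply: mW => //; exact:
    measurable_ascending.
rewrite -(fineK (fin_num_measure P _ mA)).
rewrite sumEFin sumr_const card_Sn => -[h].
have n0 : n`!%:R != 0 :> R by rewrite pnatr_eq0 -lt0n fact_gt0.
by congr (_%:E); apply: (mulfI n0); rewrite mulr_natl h divff.
Qed.

End exchangeability.

(** * Joint exchangeability of signal and observation *)

Lemma measurable_add_scaled_pair (R : realType) n (s : R) :
  measurable_fun setT (fun p : n.-tuple R * n.-tuple R => (p.1, add_scaled p.1 s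
    p.2)).
Proof.
apply: measurable_fun_pair => //; apply/measurable_fun_tnthP => i.
rewrite (_ : _ \o _ = fun p : n.-tuple R * n.-tuple R => tnth p.1 i + s * tnth
  p.2 i).
  apply: measurable_funD; first exact: (measurableT_comp (measurable_tnth i)).
  by apply: measurable_funM => //; exact: (measurableT_comp (measurable_tnth
    i)).
by apply/funext => z /=; rewrite tnth_mktuple.
Qed.

Lemma measurable_noise (R : realType) n (mu : probability (n.-tuple R) R) (s :
  R)
    (C : set (n.-tuple R * n.-tuple R)) : measurable C ->
  measurable_fun setT (fun x => mu [set z | C (x, add_scaled x s z)]).
Proof.
move=> mC.
rewrite (_ : (fun _ => _) = mu \o xsection [set p | C (p.1, add_scaled p.1 s
  p.2)]).
  apply: measurable_fun_xsection; rewrite -[X in measurable X]setTI.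
  exact: measurable_add_scaled_pair.
apply/funext => x /=; congr (mu _).
by apply/funext => z; rewrite /xsection/= asboolE.
Qed.

Section joint_law.
Context d (T : measurableType d) (R : realType) (P : probability T R) (n : nat).
Variables (X Y : T -> n.-tuple R) (s : R).
Hypotheses (s0 : 0 < s) (mX : measurable_fun setT X) (mY : measurable_fun setT
  Y).
Hypothesis XY : cond_gaussian P X Y s.

Lemma joint_law_integral (mu : probability (n.-tuple R) R) : iid_normal mu ->
  forall C, measurable C -> P [set w | C (X w, Y w)] =
    (\int[P]_w mu [set z | C (X w, add_scaled (X w) s z)])%E.
Proof.
move=> iid C mC; rewrite (coupling_law s0 mX mY XY iid mC) /product_measure1.
apply: eq_integral => w _ /=; congr (mu _).
by apply/funext => z; rewrite /xsection/= asboolE.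
Qed.

(** Given [X = x], a tie of the observation at [i] and [j] means that the noise satisfies
    [z_i = z_j + (x_j - x_i) / s], a null event by [iid_normal_tie]. *)
Lemma joint_tie : forall i j : 'I_n, i != j -> P [set w | tnth (Y w) i = tnth (Y
  w) j] = 0%E.
Proof.
move=> i j ij; have [mu [iid _]] := exists_iid_normal R n.
have mC : measurable [set p : n.-tuple R * n.-tuple R | tnth p.2 i = tnth p.2
  j].
  exact: (measurable_tie _ _ (measurable_snd)).
rewrite (joint_law_integral iid mC); apply: integral0_eq => w _ /=.
rewrite -(iid_normal_tie ((tnth (X w) j - tnth (X w) i) / s) iid ij).
congr (mu _); apply/seteqP; split => z /=; rewrite !tnth_mktuple => h.
  apply: (mulfI (lt0r_neq0 s0)); rewrite mulrDr (mulrC s (_ / _)) divfK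
    ?gt_eqF//.
  by lra.
rewrite h mulrDr (mulrC s (_ / _)) divfK ?gt_eqF//.
by lra.
Qed.

Hypothesis exX : exchangeable P X.

(** The signal is exchangeable, and the noise is too, its law being a product of equal factors.
    Since the two are independent, a common permutation preserves the pair; rectangles suffice to
    check this. *)
Lemma joint_exchangeable (p : 'S_n) C : measurable C ->
  P [set w | C (permvec p (X w), permvec p (Y w))] = P [set w | C (X w, Y w)].
Proof.
have mpX : measurable_fun setT (permvec p \o X).
  exact: measurableT_comp (measurable_permvec p) mX.
have mpY : measurable_fun setT (permvec p \o Y).
  exact: measurableT_comp (measurable_permvec p) mY.
move=> mC; have [mu [iid _]] := exists_iid_normal R n.
have [m1 m1E] := pushforward_probability P (measurable_fun_pair mpX mpY).
have [m2 m2E] := pushforward_probability P (measurable_fun_pair mX mY).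
transitivity (m1 C); first by rewrite m1E.
transitivity (m2 C); last by rewrite m2E.
apply: (@measure_eq_rect _ _ m1 m2) => // A B mA mB.
rewrite m1E m2E.
pose D := A `*` [set y | forall i, B i (tnth y i)].
have mD : measurable D by apply: measurableX => //; exact: measurable_rect.
pose D' := [set q : n.-tuple R * n.-tuple R | D (permvec p q.1, permvec p q.2)].
have mD' : measurable D'.
  rewrite -[X in measurable X]setTI.
  have : measurable_fun setT (fun q : n.-tuple R * n.-tuple R => (permvec p q.1,
    permvec p q.2)).
    by apply: measurable_fun_pair; exact: (measurableT_comp (measurable_permvec
      p)).
  exact.
transitivity (P [set w | D' (X w, Y w)]) => //.
transitivity (P [set w | D (X w, Y w)]) => //.
rewrite !(joint_law_integral iid)//.
(* Exchangeability of [X] puts [permvec p (X w)] on the right-hand side as well, so the integrands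
   can be compared for each [w]. *)
rewrite -(@eq_law_integral _ _ _ P _ _ (permvec p \o X) X (fun x => mu [set z |
  D (x, add_scaled x s z)])) //.
- apply: eq_integral => w _; rewrite /D' /D /=.
  have [Aw|nAw] := pselect (A (permvec p (X w))); last first.
    by rewrite [X in mu X](_ : _ = set0) 1?[in RHS](_ : [set _ | _] = set0)//;
      apply/seteqP; split => z // -[].
  have maff a B0 : measurable B0 -> measurable [set u : R | B0 (a + s * u)].
    move=> mB0; rewrite -[X in measurable X]setTI.
    have : measurable_fun setT (fun z : R => a + s * z).
      by apply: measurable_funD => //; exact: measurable_funM.
    exact.
  (* [E i] holds the noise values admissible for entry [i]. On the left they constrain coordinate
     [p i] of [z], on the right coordinate [i]; the two products differ by a reindexing. *)
  pose E i := [set u | B i (tnth (permvec p (X w)) i + s * u)].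
  have mE i : measurable (E i) by exact: maff.
  transitivity (mu [set z | forall i, E (p^-1%g i) (tnth z i)]).
    congr (mu _); apply/seteqP; split => z /=.
      by move=> [_ h] i; have := h (p^-1%g i); rewrite /E/= !tnth_mktuple
        permKV.
    by move=> h; split=> // i; have := h (p i); rewrite /E/= !tnth_mktuple
      permK.
  rewrite (@iid (fun i => E (p^-1%g i)))//.
  transitivity (mu [set z | forall i, E i (tnth z i)]).
    rewrite iid// [RHS](reindex_inj (@perm_inj _ p^-1%g))/=.
    by apply: eq_bigr.
  congr (mu _); apply/seteqP; split => z /=.
    by move=> h; split => // i; have := h i; rewrite /E/= !tnth_mktuple.
  by move=> [_ h] i; have := h i; rewrite /E/= !tnth_mktuple.
- by move=> A' mA'; rewrite (exX p mA').
- exact: measurable_noise.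
Qed.

Lemma joint_exchangeable_integral (p : 'S_n) (F : n.-tuple R * n.-tuple R ->
  \bar R) :
  measurable_fun setT F -> (forall q, 0 <= F q)%E ->
  (\int[P]_w F (permvec p (X w), permvec p (Y w)) = \int[P]_w F (X w, Y w))%E.
Proof.
move=> mF F0.
apply: (@eq_law_integral _ _ _ P _ _ (fun w => (permvec p (X w), permvec p (Y
  w)))
  (fun w => (X w, Y w))) => //.
- by apply: measurable_fun_pair; exact: (measurableT_comp (measurable_permvec
    p)).
- exact: measurable_fun_pair.
- by move=> A mA; exact: joint_exchangeable.
Qed.

Lemma observation_exchangeable (p : 'S_n) (A : set (n.-tuple R)) : measurable A
  ->
  P [set w | A (permvec p (Y w))] = P (Y @^-1` A).
Proof.
move=> mA; apply: (@joint_exchangeable p (snd @^-1` A)).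
by rewrite -[X in measurable X]setTI; exact: measurable_snd.
Qed.

Lemma observation_ascending : P (Y @^-1` ascending) = ((n`!%:R)^-1)%:E.
Proof.
apply: ascending_probability => //; last exact: joint_tie.
by move=> p; apply: observation_exchangeable; exact: measurable_ascending.
Qed.

End joint_law.

(** * Versions of the posterior probability with values in [[0, 1]] *)

Section integral_lemmas.
Context d (T : measurableType d) (R : realType) (P : probability T R).

Lemma integral_indicM (D : set T) (f : T -> R) :
  (\int[P]_(w in D) (f w)%:E = \int[P]_w (\1_D w * f w)%:E)%E.
Proof.
rewrite integral_mkcond; apply: eq_integral => w _.
by rewrite patchE indicE; case: ifP => _; rewrite ?mul1r ?mul0r.
Qed.

Lemma null_of_integral_le0 (D : set T) (f : T -> R) :
  measurable D -> measurable_fun D f -> (forall w, D w -> 0 < f w) ->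
  (\int[P]_(w in D) (f w)%:E <= 0)%E -> P D = 0%E.
Proof.
move=> mD mf f0 If.
have : (\int[P]_(w in D) `|(f w)%:E| = 0)%E.
  apply/eqP; rewrite eq_le integral_ge0// andbT.
  by under eq_integral => w /set_mem Dw do rewrite gee0_abs ?lee_fin ?(ltW (f0 _
    Dw))//.
move/ae_eq_integral_abs => /(_ mD) /=.
have mE : measurable_fun D (EFin \o f) by exact/measurable_EFinP.
move=> /(_ mE) [N [mN N0 DN]]; apply/eqP; rewrite eq_le measure_ge0 andbT -N0.
apply: le_measure; rewrite ?inE// => w Dw; apply: DN => /(_ Dw) [] fw.
by have := f0 _ Dw; rewrite fw ltxx.
Qed.

Lemma integral_prob (D : set T) : measurable D -> P D = (\int[P]_(w in D) (1 :
  R)%:E)%E.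
Proof. by move=> mD; rewrite integral_cst// mul1e. Qed.

End integral_lemmas.

Section clipping.
Context d (T : measurableType d) (R : realType) (P : probability T R) (n : nat).
Variables (X Y : T -> n.-tuple R) (S : set (n.-tuple R)) (h : n.-tuple R -> R).
Hypotheses (mX : measurable_fun setT X) (mY : measurable_fun setT Y) (mS :
  measurable S).

Let mYB B : measurable B -> measurable (Y @^-1` B).
Proof. by move=> mB; rewrite -[X in measurable X]setTI; exact: mY. Qed.

(** A version [h] is only determined up to a null set [N], so it may leave
    [[0, 1]] there. *)
Lemma cond_prob_version_clip : cond_prob_version P X Y S h ->
  exists h' : n.-tuple R -> R, exists N,
  [/\ cond_prob_version P X Y S h', forall y, 0 <= h' y <= 1,
      measurable N, P (Y @^-1` N) = 0%E & forall y, ~ N y -> h y = h' y].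
Proof.
move=> [mh hP].
pose h' y := Num.max 0 (Num.min 1 (h y)).
pose L := [set y | h y < 0]; pose U := [set y | 1 < h y].
have mL : measurable L.
  rewrite (_ : L = h @^-1` `]-oo, 0[).
    by rewrite -[X in measurable X]setTI; apply: mh => //; exact:
      measurable_itv.
  by apply/seteqP; split => y /=; rewrite in_itv.
have mU : measurable U.
  rewrite (_ : U = h @^-1` `]1, +oo[).
    by rewrite -[X in measurable X]setTI; apply: mh => //; exact:
      measurable_itv.
  by apply/seteqP; split => y /=; rewrite in_itv/= andbT.
have mSX : measurable (X @^-1` S) by rewrite -[X in measurable X]setTI; exact:
  mX.
have mhY : measurable_fun setT (h \o Y) by exact: measurableT_comp.
(* The integral of [h] over this event is a probability, hence nonnegative, although [h < 0]
   there. *)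
have PL : P (Y @^-1` L) = 0%E.
  apply: (@null_of_integral_le0 _ _ _ P _ (fun w => - h (Y w))).
  - exact: mYB.
  - by apply: measurable_funTS; apply: measurable_funN.
  - by move=> w Lw; rewrite oppr_gt0.
  rewrite -leeN2 oppe0 -integral_ge0N; last first.
    by move=> w Lw; rewrite lee_fin oppr_ge0 ltW.
  under eq_integral do rewrite -EFinN opprK.
  by rewrite -hP.
(* The integral of [h] over this event is at most its probability, so [h - 1] has integral at most
   [0] although it is positive there. *)
have PU : P (Y @^-1` U) = 0%E.
  apply: (@null_of_integral_le0 _ _ _ P _ (fun w => h (Y w) - 1)).
  - exact: mYB.
  - by apply: measurable_funTS; apply: measurable_funB.
  - by move=> w Lw; rewrite subr_gt0.
  have : (P (X @^-1` S `&` Y @^-1` U) <= P (Y @^-1` U))%E.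
    by apply: le_measure; rewrite ?inE//; [apply: measurableI => //|]; exact:
      mYB.
  rewrite hP// [leRHS]integral_prob; last exact: mYB.
  rewrite (eq_integral (fun w => (h (Y w) - 1)%:E + (1%:E : \bar R))%E); last
    first.
    by move=> w _; rewrite -EFinD subrK.
  rewrite ge0_integralD//.
  - rewrite -integral_prob; last exact: mYB.
    have fU : P (Y @^-1` U) \is a fin_num by apply: fin_num_measure; exact: mYB.
    by rewrite -[leRHS]add0e leeD2rE.
  - exact: mYB.
  - by move=> w Uw; rewrite lee_fin subr_ge0 ltW.
  - by apply/measurable_EFinP; apply: measurable_funTS; exact: measurable_funB.
have h'E y : ~ (L `|` U) y -> h y = h' y.
  move=> /not_orP[]; rewrite /L /U /h' /= => /negP; rewrite -leNgt => h0 /negP;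
    rewrite -leNgt => h1.
  by rewrite (min_idPr _)// (max_idPr _).
have mh' : measurable_fun setT h'.
  by apply: measurable_maxr => //; exact: measurable_minr.
have PN : P (Y @^-1` (L `|` U)) = 0%E by rewrite preimage_setU null_set_setU//;
  exact: mYB.
exists h', (L `|` U); split => //; last exact: measurableU; last first.
  by move=> y; rewrite /h' le_max lexx/= ge_max ler01 ge_min lexx.
split => // B mB; rewrite hP//.
apply: ae_eq_integral.
- exact: mYB.
- by apply/measurable_EFinP; exact: measurable_funTS.
- by apply/measurable_EFinP; apply: measurable_funTS; exact: measurableT_comp.
exists (Y @^-1` (L `|` U)); split => //; first by apply: mYB; exact:
  measurableU.
by move=> w /= hw; apply: contrapT => /h'E E; apply: hw => _; rewrite E.
Qed.

End clipping.

(** * Reduction to an unconditional expectation *)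

Section reduction.
Context d (T : measurableType d) (R : realType) (P : probability T R) (n : nat).
Variables (X Y : T -> n.-tuple R) (s : R).
Hypotheses (s0 : 0 < s) (mX : measurable_fun setT X) (mY : measurable_fun setT
  Y).
Hypothesis XY : cond_gaussian P X Y s.
Hypothesis exX : exchangeable P X.
Hypothesis X2 : forall k : 'I_n, P.-integrable setT (fun w => ((tnth (X w) k) ^+
  2)%:E).

Lemma integrable_sqnorm : P.-integrable setT (fun w => (sqnorm (X w))%:E).
Proof.
rewrite (_ : (fun w => _) = (fun w => \sum_(i < n) ((tnth (X w) i) ^+ 2)%:E)%E).
  by apply: integrable_sum => // i _; exact: X2.
by apply/funext => w; rewrite sumEFin.
Qed.

(** Conditioning divides by [1 / n!], which yields the factor. Joint exchangeability moves each
    permutation from [g] to the indicator of the conditioning event, and these indicators sum to [1]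
    almost surely. The bounded [g'] can replace [g] because permuted copies of [N] are null for [Y]
    too. *)
Lemma conditional_sum_unconditional (g g' : n.-tuple R -> R) (N : set (n.-tuple
  R)) :
  measurable_fun setT g -> measurable_fun setT g' ->
  (forall y, 0 <= g' y <= 1) -> measurable N -> P (Y @^-1` N) = 0%E ->
  (forall y, ~ N y -> g y = g' y) ->
  \sum_(p : 'S_n) cond_expect_event P
    (fun w => sqnorm (X w) * g (permvec p (Y w))) (Y @^-1` ascending) =
  n`!%:R * Rintegral P setT (fun w => sqnorm (X w) * g' (Y w)).
Proof.
move=> mg mg' g'01 mN PN gg'.
have mA : measurable (Y @^-1` ascending).
  by rewrite -[X in measurable X]setTI; apply: mY => //; exact:
    measurable_ascending.
rewrite (eq_bigr (fun p : 'S_n => n`!%:R * Rintegral P (Y @^-1` ascending)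
    (fun w => sqnorm (X w) * g (permvec p (Y w))))); last first.
  by move=> p _; rewrite /cond_expect_event (observation_ascending s0 mX mY XY
    exX)/= invrK mulrC.
rewrite -mulr_sumr; congr (_ * _).
have mnX : measurable_fun setT (fun w => sqnorm (X w)).
  exact: measurableT_comp (@measurable_sqnorm R n) mX.
have mpY p : measurable_fun setT (fun w => permvec p (Y w)).
  exact: measurableT_comp (measurable_permvec p) mY.
have mI : measurable_fun setT (\1_ascending : n.-tuple R -> R).
  by apply: measurable_indic; exact: measurable_ascending.
pose V w := sqnorm (X w) * g' (Y w).
have V0 w : 0 <= V w.
  by rewrite mulr_ge0 ?sqnorm_ge0//; have /andP[] := g'01 (Y w).
have mV : measurable_fun setT V.
  by apply: measurable_funM => //; exact: measurableT_comp mg' mY.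
pose t (p : 'S_n) := (\int[P]_w (\1_ascending (permvec p (Y w)) * V w)%:E)%E.
(* Applying [p^-1] to both vectors leaves [sqnorm] unchanged and cancels [p] inside [g'], so the
   inverse permutation ends up in the indicator. *)
have E p : (\int[P]_(w in Y @^-1` ascending) (sqnorm (X w) * g (permvec p (Y
  w)))%:E)%E = t p^-1%g.
  transitivity (\int[P]_(w in Y @^-1` ascending) (sqnorm (X w) * g' (permvec p
    (Y w)))%:E)%E.
    apply: ae_eq_integral => //.
    - apply/measurable_EFinP; apply: measurable_funTS; apply: measurable_funM =>
        //.
      exact: measurableT_comp mg (mpY p).
    - apply/measurable_EFinP; apply: measurable_funTS; apply: measurable_funM =>
        //.
      exact: measurableT_comp mg' (mpY p).
    exists [set w | N (permvec p (Y w))]; split.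
    + by rewrite -[X in measurable X]setTI; exact: mpY.
    + by rewrite -PN; exact: (observation_exchangeable s0 mX mY XY exX).
    + by move=> w /= hw; apply: contrapT => /gg' e; apply: hw => _; rewrite e.
  rewrite integral_indicM.
  pose F (q : n.-tuple R * n.-tuple R) := (\1_ascending q.2 * (sqnorm q.1 * g'
    (permvec p q.2)))%:E.
  have mF : measurable_fun setT F.
    apply/measurable_EFinP; apply: measurable_funM; first exact:
      measurableT_comp mI _.
    apply: measurable_funM; first exact: measurableT_comp (@measurable_sqnorm R
      n) _.
    apply: measurableT_comp mg' _; exact: measurableT_comp (measurable_permvec
      p) _.
  have F0 q : (0 <= F q)%E.
    rewrite lee_fin mulr_ge0// mulr_ge0 ?sqnorm_ge0//.
    by have /andP[] := g'01 (permvec p q.2).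
  transitivity (\int[P]_w F (X w, Y w))%E => //.
  rewrite -(joint_exchangeable_integral s0 mX mY XY exX p^-1%g mF F0).
  by apply: eq_integral => w _; rewrite /F /= sqnorm_permvec permvecVK.
have := sum_ascending_integral mY mV V0 (joint_tie s0 mX mY XY).
rewrite -/(t _) /= => tV.
(* Finiteness, by domination by [sqnorm (X w)], lets [fine] commute with the sum. *)
have tfin p : t p \is a fin_num.
  rewrite ge0_fin_numE; last by apply: integral_ge0 => w _; rewrite lee_fin
    mulr_ge0.
  have /integrableP[_] := integrable_sqnorm.
  apply: le_lt_trans; apply: ge0_le_integral => //.
  - by move=> w _; rewrite lee_fin mulr_ge0.
  - apply/measurable_EFinP; apply: measurable_funM => //.
    exact: measurableT_comp mI (mpY p).
  - by apply: measurableT_comp => //; exact/measurable_EFinP.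
  move=> w _; rewrite /= lee_fin ger0_norm ?sqnorm_ge0//.
  have /andP[g0 g1] := g'01 (Y w).
  rewrite /V indicE; case: (_ \in _); rewrite ?mul0r ?mul1r ?sqnorm_ge0//.
  by rewrite ler_piMr// sqnorm_ge0.
rewrite /Rintegral -tV.
rewrite [in RHS](eq_bigr (fun p => (fine (t p))%:E)); last by move=> p _;
  rewrite fineK.
rewrite sumEFin [RHS](reindex_inj invg_inj)/=.
by apply: eq_bigr => p _; rewrite E.
Qed.

End reduction.

(** * Integrable weights against small [[0, 1]]-valued variables *)

Section vanishing.
Context d (T : measurableType d) (R : realType) (P : probability T R).

(** Truncation: [V * f] is at most [k * f] plus the part of [V] above level [k], whose integral
    tends to [0] by dominated convergence. The constant [c] is fixed before [f], so it serves all
    noise levels at once. *)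
Lemma integral_small (V : T -> R) : (forall w, 0 <= V w) ->
  P.-integrable setT (fun w => (V w)%:E) -> forall e, 0 < e ->
  exists2 c : R, 0 < c & forall f : T -> R, measurable_fun setT f ->
    (forall w, 0 <= f w <= 1) -> (\int[P]_w (f w)%:E <= c%:E)%E ->
    (\int[P]_w (V w * f w)%:E <= e%:E)%E.
Proof.
move=> V0 iV e e0.
have mV : measurable_fun setT V by apply/measurable_EFinP; case/integrableP: iV.
pose D k := [set w | (k%:R : R) < V w].
have mD k : measurable (D k).
  rewrite (_ : D k = V @^-1` `]k%:R, +oo[).
    by rewrite -[X in measurable X]setTI; apply: mV => //; exact:
      measurable_itv.
  by apply/seteqP; split => w /=; rewrite in_itv/= andbT.
pose W k w := \1_(D k) w * V w.
have mW k : measurable_fun setT (W k) by apply: measurable_funM => //; exact: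
  measurable_indic.
have W0 k w : 0 <= W k w by rewrite mulr_ge0.
have VW k w : W k w <= V w by rewrite ler_piMl// indicE lern1 leq_b1.
have Wcvg w : W k w @[k --> \oo] --> (0 : R).
  apply: cvg_near_cst; exists (Num.trunc (V w)).+1 => // k /= kV.
  rewrite /W indicE memNset ?mul0r// /D /= => /lt_le_trans.
  move=> /(_ _ (ltW (truncnS_gt _))); rewrite ltr_nat ltnNge.
  by rewrite kV.
have fcvg : {ae P, forall w, setT w -> (W k w)%:E @[k --> \oo] --> 0%E}.
  by apply: aeW => w _; apply/fine_cvgP; split; [exact: nearW|exact: Wcvg].
have fdom : {ae P, forall w k, setT w -> (`|(W k w)%:E| <= (V w)%:E)%E}.
  by apply: aeW => w k _; rewrite gee0_abs ?lee_fin.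
have [_ _] := dominated_convergence measurableT
  (fun k => (measurable_EFinP _ _).2 (mW k)) (measurable_cst (0 : \bar R)) fcvg
    iV fdom.
rewrite integral0 => /fine_cvgP[tailfin /cvgr_le tail].
have [k tailk] : exists k, (\int[P]_w (W k w)%:E <= (e / 2)%:E)%E.
  have [k [kfin ke]]
    := filter_ex (filterI tailfin (tail _ (divr_gt0 e0 (ltr0Sn R 1)))).
  by exists k; rewrite -[leLHS](fineK kfin) lee_fin.
(* Dividing by [k.+1] rather than [k] covers the level [k = 0]. *)
exists (e / 2 / k.+1%:R); first by rewrite !divr_gt0.
move=> f mf f01 If.
apply: (@le_trans _ _ (\int[P]_w ((k%:R * f w)%:E + (W k w)%:E))%E).
  apply: ge0_le_integral => //.
  - by move=> w _; rewrite lee_fin mulr_ge0//; have /andP[] := f01 w.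
  - by apply/measurable_EFinP; exact: measurable_funM.
  - apply: emeasurable_funD; apply/measurable_EFinP => //.
    exact: measurable_funM.
  move=> w _; rewrite -EFinD lee_fin /W indicE.
  have /andP[fw0 fw1] := f01 w.
  have [kV|] := pselect (D k w); last first.
    by move=> kV; rewrite memNset// mul0r addr0 ler_wpM2r// leNgt; exact/negP.
  by rewrite mem_set// mul1r ler_wpDl ?mulr_ge0// ler_piMr.
rewrite ge0_integralD//; last 4 first.
- by move=> w _; rewrite lee_fin mulr_ge0//; have /andP[] := f01 w.
- by apply/measurable_EFinP; exact: measurable_funM.
- by move=> w _; rewrite lee_fin.
- by apply/measurable_EFinP.
rewrite [e in leRHS]splitr EFinD leeD//.
under eq_integral do rewrite EFinM.
rewrite ge0_integralZl_EFin//; last 2 first.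
- by move=> w _; rewrite lee_fin; have /andP[] := f01 w.
- exact/measurable_EFinP.
apply: (@le_trans _ _ (k%:R%:E * (e / 2 / k.+1%:R)%:E)%E).
  by rewrite lee_wpmul2l// lee_fin.
rewrite -EFinM lee_fin mulrCA ler_piMr ?divr_ge0 ?(ltW e0)//.
by rewrite ler_pdivrMr// mul1r ler_nat.
Qed.
End vanishing.

(** * Small noise: signal and observation are ordered alike *)

Section small_noise.
Context d (T : measurableType d) (R : realType) (P : probability T R) (n : nat).
Variable X : T -> n.-tuple R.
Hypothesis mX : measurable_fun setT X.
Hypothesis tieX : forall i j : 'I_n, i != j -> P [set w | tnth (X w) i = tnth (X
  w) j] = 0%E.

Definition discordant : set (n.-tuple R * n.-tuple R) :=
  (ascending `*` ~` ascending) `|` (~` ascending `*` ascending).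

Lemma measurable_discordant : measurable discordant.
Proof.
have mA := @measurable_ascending R n; have mAc := measurableC mA.
by apply: measurableU; exact: measurableX.
Qed.

(** Strict inequalities between entries survive small perturbations. A vector that is not ascending
    has a strict inversion, and an ascending vector without ties is strictly ascending. *)
Lemma near_concordant (u : R ^nat) (x z : n.-tuple R) : injective (tnth x) ->
  u k @[k --> \oo] --> 0 ->
  \forall k \near \oo, ~ discordant (x, add_scaled x (u k) z).
Proof.
move=> xI u0.
have lim i : tnth x i + u k * tnth z i @[k --> \oo] --> tnth x i.
  rewrite -[X in _ --> X]addr0 -[X in _ + X](mul0r (tnth z i)).
  by apply: cvgD; [exact: cvg_cst|apply: cvgMl].
have near_lt i j : tnth x i < tnth x j ->
    \forall k \near \oo, tnth x i + u k * tnth z i < tnth x j + u k * tnth z j.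
  move=> ij; pose c := (tnth x i + tnth x j) / 2.
  have ic : tnth x i < c by rewrite midf_lt.
  have cj : c < tnth x j by rewrite midf_lt.
  near=> k; apply: (@lt_trans _ _ c); near: k.
    exact: (cvgr_lt _ (lim i)).
  exact: (cvgr_gt _ (lim j)).
have [xA|xA] := pselect (ascending x); last first.
  have [i [j [ij]]] : exists i j : 'I_n, (i <= j)%N /\ tnth x j < tnth x i.
    apply: contrapT => H; apply: xA => i j ij; rewrite leNgt; apply/negP => ji.
    by apply: H; exists i, j.
  move=> /near_lt; apply: filterS => k ji [[]//|[_ /= /(_ i j ij)]].
  by rewrite !tnth_mktuple leNgt ji.
have : \forall k \near \oo, forall ij : 'I_n * 'I_n, (ij.1 < ij.2)%N ->
    tnth x ij.1 + u k * tnth z ij.1 < tnth x ij.2 + u k * tnth z ij.2.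
  apply: filter_forall => -[i j] /=.
  have [ij|ij] := boolP (i < j)%N; last exact: nearW.
  have xij : tnth x i < tnth x j.
    rewrite lt_neqAle (xA _ _ (ltnW ij)) andbT.
    by apply: contraTneq ij => /xI ->; rewrite ltnn.
  by apply: filterS (near_lt i j xij) => k.
apply: filterS => k zA [[_ /=]|[/= ]]; last by move=> nx.
apply => i j; rewrite leq_eqVlt => /orP[/eqP/val_inj -> //|ij].
by rewrite !tnth_mktuple ltW//; exact: (zA (i, j)).
Unshelve. all: by end_near.
Qed.

(** Dominated convergence for the indicators of discordance along any sequence of positive noise
    levels tending to [0]. Pointwise convergence fails at most where [X] has a tie. *)
Lemma discordant_cvg0 (mu : probability (n.-tuple R) R) :
  fine ((P \x mu)%E [set p | discordant (X p.1, add_scaled (X p.1) s p.2)])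
    @[s --> 0^'+] --> (0 : R).
Proof.
apply/cvg_at_rightP => u [u0 ucvg].
pose E k := [set p : T * n.-tuple R | discordant (X p.1, add_scaled (X p.1) (u
  k) p.2)].
have mE k : measurable (E k).
  rewrite -[X in measurable X]setTI.
  have mc : measurable_fun setT
    (fun p : T * n.-tuple R => (X p.1, add_scaled (X p.1) (u k) p.2)).
    exact: measurable_coupled.
  by apply: mc => //; exact: measurable_discordant.
have mT := measurable_tie_free mX.
have ae0 : {ae (P \x mu)%E, forall p, setT p ->
    (\1_(E k) p)%:E @[k --> \oo] --> (0 : \bar R)}.
  exists (~` [set w | injective (tnth (X w))] `*` setT); split.
  - by apply: measurableX => //; exact: measurableC.
  - rewrite product_measure1E//; last exact: measurableC.
    by rewrite [X in (X * _)%E](tie_negligible mX tieX) mul0e.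
  move=> p /= np; split => // xI; apply: np => _.
  apply/fine_cvgP; split; first exact: nearW.
  apply: cvg_near_cst; have := near_concordant p.2 xI ucvg.
  by apply: filterS => k nd; rewrite /= indicE memNset.
have mI k : measurable_fun setT (fun p => (\1_(E k) p)%:E : \bar R).
  by apply/measurable_EFinP; exact: measurable_indic.
have i1 := @finite_measure_integrable_cst _ _ R ((P \x mu)%E : probability _ R)
  setT 1 measurableT.
have dom : {ae (P \x mu)%E, forall p k, setT p -> (`|(\1_(E k) p)%:E| <= (EFin
  \o cst (1%R : R)) p)%E}.
  by apply: aeW => p k _; rewrite gee0_abs ?lee_fin// indicE lern1 leq_b1.
have [_ _] := dominated_convergence measurableT mI (measurable_cst (0 : \bar R))
  ae0 i1 dom.
rewrite integral0 => /fine_cvgP[_].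
apply: cvg_trans; apply: near_eq_cvg; apply: nearW => k /=.
by rewrite integral_indic// setIT.
Qed.

End small_noise.

(** * Bounds on the posterior probability *)

Section posterior_bounds.
Context d (T : measurableType d) (R : realType) (P : probability T R) (n : nat).
Variables (X Y : T -> n.-tuple R) (h : n.-tuple R -> R) (S : set (n.-tuple R)).
Hypotheses (mX : measurable_fun setT X) (mY : measurable_fun setT Y) (mS :
  measurable S).
Hypotheses (hP : cond_prob_version P X Y S h) (h01 : forall y, 0 <= h y <= 1).

Let mYB B : measurable B -> measurable (Y @^-1` B).
Proof. by move=> mB; rewrite -[X in measurable X]setTI; exact: mY. Qed.

Let mXB B : measurable B -> measurable (X @^-1` B).
Proof. by move=> mB; rewrite -[X in measurable X]setTI; exact: mX. Qed.

Let mhY : measurable_fun setT (h \o Y).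
Proof. by case: hP => mh _; exact: measurableT_comp. Qed.

Lemma cond_prob_version_setC B : measurable B ->
  (\int[P]_(w in Y @^-1` B) (1 - h (Y w))%:E)%E = P (X @^-1` (~` S) `&` Y @^-1`
    B).
Proof.
move=> mB; have [_ hB] := hP.
have mD := mYB mB; have mSX := mXB mS.
have : (\int[P]_(w in Y @^-1` B) (1 - h (Y w))%:E +
        P (X @^-1` S `&` Y @^-1` B) = P (Y @^-1` B))%E.
  rewrite hB// -ge0_integralD//.
  - rewrite [RHS]integral_prob//; apply: eq_integral => w _.
    by rewrite -EFinD subrK.
  - by move=> w _; rewrite lee_fin subr_ge0; have /andP[] := h01 (Y w).
  - apply/measurable_EFinP; apply: measurable_funTS; exact: measurable_funB.
  - by move=> w _; rewrite lee_fin; have /andP[] := h01 (Y w).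
  - by apply/measurable_EFinP; exact: measurable_funTS.
have -> : P (Y @^-1` B) =
    (P (X @^-1` (~` S) `&` Y @^-1` B) + P (X @^-1` S `&` Y @^-1` B))%E.
  rewrite -measureU//; first by rewrite -setIUl preimage_setC setUC setUv setTI.
  - by apply: measurableI => //; rewrite preimage_setC; exact: measurableC.
  - exact: measurableI.
  - by rewrite setIACA preimage_setC setICl set0I.
have f : P (X @^-1` S `&` Y @^-1` B) \is a fin_num.
  by apply: fin_num_measure; exact: measurableI.
by move=> /(congr1 (fun r => r - P (X @^-1` S `&` Y @^-1` B))%E); rewrite
  !addeK.
Qed.

(** Pointwise, [h * (1 - h)] is at most [1 - h] on [B] and at most [h] off [B]. The right-hand side
    is the error probability of guessing that [X] is in [S] exactly when [Y] is in [B]. *)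
Lemma cond_var_le B : measurable B ->
  (\int[P]_w (h (Y w) * (1 - h (Y w)))%:E <=
   P (X @^-1` (~` S) `&` Y @^-1` B) + P (X @^-1` S `&` Y @^-1` (~` B)))%E.
Proof.
move=> mB; have [_ hB] := hP.
have mh1 : measurable_fun setT (fun w => 1 - h (Y w)) by exact: measurable_funB.
have mIB : measurable_fun setT (\1_(Y @^-1` B) : T -> R) by apply:
  measurable_indic; exact: mYB.
have mIC : measurable_fun setT (\1_(Y @^-1` (~` B)) : T -> R).
  by apply: measurable_indic; apply: mYB; exact: measurableC.
rewrite -(cond_prob_version_setC mB) hB; last exact: measurableC.
rewrite (integral_indicM _ (Y @^-1` B)) (integral_indicM _ (Y @^-1` (~` B))).
rewrite -ge0_integralD//; last 4 first.
- by move=> w _; rewrite lee_fin mulr_ge0// subr_ge0; have /andP[] := h01 (Y w).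
- by apply/measurable_EFinP; exact: measurable_funM.
- by move=> w _; rewrite lee_fin mulr_ge0//; have /andP[] := h01 (Y w).
- by apply/measurable_EFinP; exact: measurable_funM.
apply: ge0_le_integral => //.
- move=> w _; have /andP[? ?] := h01 (Y w).
  by rewrite lee_fin mulr_ge0// subr_ge0.
- by apply/measurable_EFinP; exact: measurable_funM.
- by apply: emeasurable_funD; apply/measurable_EFinP; exact: measurable_funM.
move=> w _; rewrite -EFinD lee_fin !indicE.
have /andP[h0 h1] := h01 (Y w).
have [wB|wB] := pselect (B (Y w)).
  rewrite mem_set// memNset; last by apply.
  by rewrite mul1r mul0r addr0 ler_piMl// subr_ge0.
by rewrite memNset// mem_set// mul0r add0r mul1r ler_piMr// gerBl.
Qed.

(** Split according to the sign of [h - p]. The integral of [h - p] over [U] is the excess of the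
    joint probability over the product, hence at most [eta]. The negative part has the same
    integral, since [h - p] has mean [0]; this gives the factor [2]. *)
Lemma cond_prob_L1 (eta : R) :
  (forall B, measurable B ->
     fine (P (X @^-1` S `&` Y @^-1` B)) <=
     fine (P (X @^-1` S)) * fine (P (Y @^-1` B)) + eta) ->
  (\int[P]_w `|h (Y w) - fine (P (X @^-1` S))|%:E <= (2 * eta)%:E)%E.
Proof.
move=> etaP; have [mh hB] := hP.
set p := fine (P (X @^-1` S)).
pose U := [set y | p < h y].
have mU : measurable U.
  rewrite (_ : U = h @^-1` `]p, +oo[).
    by rewrite -[X in measurable X]setTI; apply: mh => //; exact:
      measurable_itv.
  by apply/seteqP; split => y /=; rewrite in_itv/= andbT.
have mUc := measurableC mU.
have fX B : measurable B -> P (X @^-1` S `&` Y @^-1` B) = (fine (P (X @^-1` S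
  `&` Y @^-1` B)))%:E.
  move=> mB; rewrite fineK//; apply: fin_num_measure; apply: measurableI;
    [exact: mXB|exact: mYB].
have fY B : measurable B -> P (Y @^-1` B) = (fine (P (Y @^-1` B)))%:E.
  by move=> mB; rewrite fineK//; apply: fin_num_measure; exact: mYB.
have IY B : measurable B -> (\int[P]_(w in Y @^-1` B) p%:E = (p * fine (P (Y
  @^-1` B)))%:E)%E.
  by move=> mB; rewrite integral_cst ?EFinM -?fY//; exact: mYB.
have p0 : 0 <= p by exact: fine_ge0.
have mhp : measurable_fun setT (fun w => h (Y w) - p) by exact: measurable_funB.
have mph : measurable_fun setT (fun w => p - h (Y w)) by exact: measurable_funB.
have EU : (\int[P]_(w in Y @^-1` U) (h (Y w) - p)%:E =
    (fine (P (X @^-1` S `&` Y @^-1` U)) - p * fine (P (Y @^-1` U)))%:E)%E.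
  rewrite EFinB -fX// hB//.
  rewrite [X in _ = (X - _)%E](eq_integral (fun w => (h (Y w) - p)%:E +
    p%:E)%E); last first.
    by move=> w _; rewrite -EFinD subrK.
  rewrite ge0_integralD//.
  - by rewrite IY// addeK.
  - exact: mYB.
  - by move=> w Uw; rewrite lee_fin subr_ge0 ltW.
  - by apply/measurable_EFinP; exact: measurable_funTS.
have EUc : (\int[P]_(w in Y @^-1` (~` U)) (p - h (Y w))%:E =
    (p * fine (P (Y @^-1` (~` U))) - fine (P (X @^-1` S `&` Y @^-1` (~`
      U))))%:E)%E.
  rewrite EFinB -IY// -fX// hB//.
  rewrite [X in _ = (X - _)%E](eq_integral (fun w => (p - h (Y w))%:E + (h (Y
    w))%:E)%E); last first.
    by move=> w _; rewrite -EFinD subrK.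
  rewrite ge0_integralD//.
  - by rewrite -hB// fX// addeK.
  - exact: mYB.
  - by move=> w /negP; rewrite -leNgt => Uw; rewrite lee_fin subr_ge0.
  - by apply/measurable_EFinP; exact: measurable_funTS.
  - by move=> w _; rewrite lee_fin; have /andP[] := h01 (Y w).
  - by apply/measurable_EFinP; exact: measurable_funTS.
have mIU : measurable_fun setT (\1_(Y @^-1` U) : T -> R) by apply:
  measurable_indic; exact: mYB.
have mIC : measurable_fun setT (\1_(Y @^-1` (~` U)) : T -> R).
  by apply: measurable_indic; exact: mYB.
rewrite (eq_integral (fun w => (\1_(Y @^-1` U) w * (h (Y w) - p))%:E +
    (\1_(Y @^-1` (~` U)) w * (p - h (Y w)))%:E)%E); last first.
  move=> w _; rewrite -EFinD !indicE; congr (_%:E).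
  have [wU|wU] := pselect (U (Y w)).
    rewrite mem_set// memNset; last by apply.
    by rewrite mul1r mul0r addr0 gtr0_norm// subr_gt0.
  rewrite memNset// mem_set// mul0r add0r mul1r ler0_norm ?opprB//.
  by rewrite subr_le0 leNgt; exact/negP.
have I0 w : 0 <= \1_(Y @^-1` U) w * (h (Y w) - p).
  rewrite indicE; have [wU|wU] := pselect (U (Y w)).
    by rewrite mem_set// mul1r subr_ge0 ltW.
  by rewrite memNset// mul0r.
have I1 w : 0 <= \1_(Y @^-1` (~` U)) w * (p - h (Y w)).
  rewrite indicE; have [wU|wU] := pselect (U (Y w)).
    by rewrite memNset ?mul0r//; apply.
  by rewrite mem_set// mul1r subr_ge0 leNgt; exact/negP.
rewrite ge0_integralD//; last 4 first.
- by move=> w _; rewrite lee_fin.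
- by apply/measurable_EFinP; exact: measurable_funM.
- by move=> w _; rewrite lee_fin.
- by apply/measurable_EFinP; exact: measurable_funM.
rewrite -(integral_indicM _ (Y @^-1` U) (fun w => h (Y w) - p)).
rewrite -(integral_indicM _ (Y @^-1` (~` U)) (fun w => p - h (Y w))).
rewrite EU EUc -EFinD lee_fin.
(* Expressing both probabilities on the complement through those on [U] makes the two halves
   equal. *)
have XU : fine (P (X @^-1` S `&` Y @^-1` (~` U))) = p - fine (P (X @^-1` S `&` Y
  @^-1` U)).
  apply/eqP; rewrite eq_sym subr_eq; apply/eqP.
  rewrite /p -fineD; [|by rewrite fX..].
  rewrite -measureU; first by rewrite -setIUr preimage_setC setUC setUv setIT.
  - apply: measurableI; [exact: mXB|exact: mYB].
  - apply: measurableI; [exact: mXB|exact: mYB].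
  - by rewrite setIACA preimage_setC setICl setI0.
have YU : fine (P (Y @^-1` (~` U))) = 1 - fine (P (Y @^-1` U)).
  rewrite preimage_setC probability_setC; last exact: (mYB mU).
  by rewrite fineB// (fin_num_measure P _ (mYB mU)).
have := etaP _ mU; rewrite -/p XU YU.
set a := fine _; set b := fine _ => abeta.
by lra.
Qed.

End posterior_bounds.

(** * Large noise: signal and observation are nearly independent *)

Section large_noise.
Context d (T : measurableType d) (R : realType) (P : probability T R) (n : nat).
Variable X : T -> n.-tuple R.
Hypothesis mX : measurable_fun setT X.

Let mXB B : measurable B -> measurable (X @^-1` B).
Proof. by move=> mB; rewrite -[X in measurable X]setTI; exact: mX. Qed.

Lemma measurable_sqnorm_gt (M : R) : measurable [set w | M < sqnorm (X w)].
Proof.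
rewrite (_ : [set _ | _] = (fun w => sqnorm (X w)) @^-1` `]M, +oo[).
  rewrite -[X in measurable X]setTI.
  have : measurable_fun setT (fun w => sqnorm (X w)).
    exact: measurableT_comp (@measurable_sqnorm R n) mX.
  by apply => //; exact: measurable_itv.
by apply/seteqP; split => w /=; rewrite in_itv/= andbT.
Qed.

(** The factor of [shift_dominated], made uniform over all [x] with [sqnorm x <= M]. *)
Definition shift_const (M s t : R) := (t / s) ^+ n * expR (M / (2 * (t ^+ 2 - s
  ^+ 2))).

(** Where [sqnorm (X w) <= M], the conditional law of [Y] is dominated by a multiple of a law that
    does not depend on [X w]. Elsewhere the conditional probability is bounded by [1], at the cost
    of the tail term. *)
Lemma joint_le_product (Y : T -> n.-tuple R) (s t M : R) (mu : probability
  (n.-tuple R) R) A B :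
  0 < s -> s < t -> 0 <= M -> measurable_fun setT Y -> cond_gaussian P X Y s ->
  iid_normal mu -> shift_dominated mu -> measurable A -> measurable B ->
  fine (P (X @^-1` A `&` Y @^-1` B)) <=
  shift_const M s t * fine (P (X @^-1` A)) *
    fine (mu (add_scaled (nseq_tuple n 0) t @^-1` B)) +
  fine (P [set w | M < sqnorm (X w)]).
Proof.
move=> s0 st M0 mY XY iid shift mA mB.
have mXA := mXB mA; have mM := measurable_sqnorm_gt M.
have mBt : measurable (add_scaled (nseq_tuple n (0 : R)) t @^-1` B).
  by rewrite -[X in measurable X]setTI; exact: measurable_add_scaled.
set G := mu _; set C := shift_const M s t.
have t2 : 0 < t ^+ 2 - s ^+ 2.
  by rewrite subr_gt0 ltr_pXn2r// ?nnegrE ltW// (lt_trans s0).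
have C0 : 0 <= C.
  by rewrite mulr_ge0 ?expR_ge0// exprn_ge0// divr_ge0 ?ltW// (lt_trans s0).
have G0 : 0 <= fine G by apply: fine_ge0; exact: measure_ge0.
have fG : G \is a fin_num by exact: fin_num_measure.
rewrite -lee_fin fineK; last first.
  by apply: fin_num_measure; apply: measurableI => //; rewrite -[X in measurable
    X]setTI; exact: mY.
rewrite (coupling_integral s0 mX mY XY iid mA mB).
apply: (@le_trans _ _ (\int[P]_(w in X @^-1` A)
   ((C * fine G)%:E + (\1_[set w | M < sqnorm (X w)] w)%:E))%E).
  apply: ge0_le_integral => //.
  - apply: measurable_funTS.
    rewrite (_ : (fun x => _) = (fun x => mu [set z | (snd @^-1` B) (x,
      add_scaled x s z)]) \o X)//.
    apply: measurableT_comp => //; apply: measurable_noise.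
    by rewrite -[X in measurable X]setTI; exact: measurable_snd.
  - by apply: emeasurable_funD => //; apply/measurable_EFinP; exact:
      measurable_indic.
  move=> w _ /=; rewrite indicE.
  have [wM|wM] := pselect (M < sqnorm (X w)).
    rewrite mem_set//; apply: (@le_trans _ _ 1%E); first apply: probability_le1.
      by rewrite -[X in measurable X]setTI; exact: measurable_add_scaled.
    by apply: leeDr; rewrite lee_fin; exact: mulr_ge0.
  rewrite memNset// adde0 EFinM fineK//.
  apply: le_trans (shift (X w) s t B s0 st mB) _.
  apply: lee_wpmul2r => //; rewrite lee_fin /C /shift_const.
  apply: ler_wpM2l; first by rewrite exprn_ge0// divr_ge0 ?ltW// (lt_trans s0).
  rewrite ler_expR ler_wpM2r ?invr_ge0 ?mulr_ge0 ?(ltW t2)//.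
  by rewrite leNgt; exact/negP.
rewrite ge0_integralD//; last 2 first.
- by move=> w _; rewrite lee_fin mulr_ge0.
- by apply/measurable_EFinP; exact: measurable_indic.
rewrite EFinD leeD//.
  rewrite integral_cst// -[X in (_ * X)%E]fineK; last exact: fin_num_measure.
  by rewrite -EFinM lee_fin mulrAC.
rewrite integral_indic// fineK; last exact: fin_num_measure.
by apply: le_measure; rewrite ?inE//; exact: measurableI.
Qed.

(** The product bound involves the law of the centred noise of scale [t] instead of that of [Y].
    Used once more, for the complement of [B] and the whole space in place of [A], it bounds that
    noise probability by the one of [Y]. *)
Lemma joint_nearly_independent (Y : T -> n.-tuple R) (s t M : R) A B :
  0 < s -> s < t -> 0 <= M -> measurable_fun setT Y -> cond_gaussian P X Y s ->
  measurable A -> measurable B ->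
  fine (P (X @^-1` A `&` Y @^-1` B)) <=
  fine (P (X @^-1` A)) * fine (P (Y @^-1` B)) +
  (shift_const M s t - 1 + 2 * fine (P [set w | M < sqnorm (X w)])).
Proof.
move=> s0 st M0 mY XY mA mB.
have [mu [iid shift]] := exists_iid_normal R n.
have mBt : measurable (add_scaled (nseq_tuple n (0 : R)) t @^-1` B).
  by rewrite -[X in measurable X]setTI; exact: measurable_add_scaled.
have mYB : measurable (Y @^-1` B) by rewrite -[X in measurable X]setTI; exact:
  mY.
have H1 := joint_le_product s0 st M0 mY XY iid shift mA mB.
have := joint_le_product s0 st M0 mY XY iid shift measurableT (measurableC mB).
rewrite preimage_setT setTI 2!preimage_setC (probability_setC P mYB)
  (probability_setC mu mBt).
rewrite probability_setT /= !fineB ?fin_num_measure//= mulr1 => H2.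
have t2 : 0 < t ^+ 2 - s ^+ 2.
  by rewrite subr_gt0 ltr_pXn2r// ?nnegrE ltW// (lt_trans s0).
have C1 : 1 <= shift_const M s t.
  have ts1 : 1 <= (t / s) ^+ n by rewrite exprn_ege1// ler_pdivlMr// mul1r ltW.
  have e1 : 1 <= expR (M / (2 * (t ^+ 2 - s ^+ 2))).
    by rewrite -expR0 ler_expR divr_ge0// mulr_ge0// ltW.
  by rewrite -[leLHS]mulr1 ler_pM.
move: H1 H2 C1; set C := shift_const _ _ _.
have e0 : 0 <= fine (P [set w | M < sqnorm (X w)]) by exact: fine_ge0.
move: e0; set e := fine (P [set w | _]).
have a0 : 0 <= fine (P (X @^-1` A)) by exact: fine_ge0.
have a1 : fine (P (X @^-1` A)) <= 1.
  rewrite -lee_fin fineK; first exact: (probability_le1 P (mXB mA)).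
  by apply: fin_num_measure; exact: mXB.
move: a0 a1; set a := fine (P (X @^-1` A)).
set b := fine (P (Y @^-1` B)); set G := fine (mu _).
move=> a0 a1 e0 H1 H2 C1.
(* The complement bound [H2] says [1 - b <= C * (1 - G) + e], that is [C * G <= b + C - 1 + e]. *)
have aH : a * (C * G) <= a * (b + C - 1 + e) by apply: ler_wpM2l => //; lra.
have aC : a * (C - 1 + e) <= C - 1 + e by rewrite ler_piMl//; lra.
by nra.
Qed.

Lemma sqnorm_tail : P.-integrable setT (fun w => (sqnorm (X w))%:E) ->
  forall e, 0 < e -> exists2 M, 0 <= M & fine (P [set w | M < sqnorm (X w)]) <=
    e.
Proof.
move=> iX e e0.
have mn : measurable_fun setT (fun w => sqnorm (X w)).
  exact: measurableT_comp (@measurable_sqnorm R n) mX.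
pose K := fine (\int[P]_w (sqnorm (X w))%:E).
have K0 : 0 <= K by apply: fine_ge0; apply: integral_ge0 => w _; rewrite lee_fin
  sqnorm_ge0.
(* Markov's inequality gives a tail of at most [K / M]; the added [1] keeps [M] positive when
   [K = 0]. *)
pose M := (K + 1) / e.
have M0 : 0 < M by rewrite divr_gt0// ltr_wpDl.
exists M; first exact: ltW.
have mM := measurable_sqnorm_gt M.
have : (M%:E * P [set w | (M < sqnorm (X w))%R] <= K%:E)%E.
  rewrite /K fineK; last exact: integrable_fin_num.
  rewrite -integral_cst//.
  apply: (@le_trans _ _ (\int[P]_(w in [set w | (M < sqnorm (X w))%R]) (sqnorm
    (X w))%:E)%E).
    apply: ge0_le_integral => //.
    - by move=> w _; rewrite lee_fin ltW.
    - by apply/measurable_EFinP; exact: measurable_funTS.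
    - by move=> w /= Mw; rewrite lee_fin ltW.
  apply: ge0_subset_integral => //.
  - by apply/measurable_EFinP.
  - by move=> w _; rewrite lee_fin sqnorm_ge0.
have f := fin_num_measure P _ mM.
rewrite -[X in (_ * X)%E]fineK// -EFinM lee_fin => MP.
rewrite -(ler_pM2l M0) (le_trans MP)// /M divfK ?gt_eqF//.
by rewrite lerDl ler01.
Qed.

(** With [t = s + 1], the ratio [t / s] tends to [1] while [t ^+ 2 - s ^+ 2 = 2 * s + 1] still tends
    to infinity. In terms of [u = s^-1] the constant is at most [k u], which is continuous with
    value [1] at [0]. *)
Lemma shift_const_cvg (M : R) : 0 <= M ->
  forall e, 0 < e -> \forall s \near +oo, shift_const M s (s + 1) <= 1 + e.
Proof.
move=> M0 e e0.
pose k (u : R) := (1 + u) ^+ n * expR (M * u).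
have kc : k u @[u --> 0] --> (1 : R).
  have -> : (1 : R) = (1 + 0) ^+ n * expR (M * 0) by rewrite addr0 expr1n mulr0
    expR0 mulr1.
  apply: cvgM.
    apply: (cvg_comp _ (fun x : R => x ^+ n)); last exact: exprn_continuous.
    by apply: cvgD; [exact: cvg_cst|exact: cvg_id].
  apply: (cvg_comp _ expR); last exact: continuous_expR.
  by apply: cvgMr; exact: cvg_id.
have inv0 : (s : R)^-1 @[s --> +oo] --> (0 : R).
  apply/(gtr0_cvgV0 (f := id)); last exact: cvg_id.
  exact: nbhs_pinfty_gt.
have kinv : k s^-1 @[s --> +oo] --> (1 : R) by exact: cvg_comp inv0 kc.
near=> s.
have s0 : 0 < s by near: s; exact: nbhs_pinfty_gt.
apply: (@le_trans _ _ (k s^-1)); last first.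
  by near: s; apply: (cvgr_le _ kinv); rewrite ltrDl.
rewrite /shift_const /k mulrDl mul1r divff ?gt_eqF//.
apply: ler_wpM2l; first by rewrite exprn_ge0// addr_ge0// invr_ge0 ltW.
rewrite ler_expR ler_wpM2l// lef_pV2 ?posrE//; nra.
Unshelve. all: by end_near.
Qed.

End large_noise.

Lemma integrable_mul_unit d (T : measurableType d) (R : realType) (P :
  probability T R)
    (V f : T -> R) : P.-integrable setT (fun w => (V w)%:E) ->
  measurable_fun setT f -> (forall w, 0 <= f w <= 1) ->
  P.-integrable setT (fun w => (V w * f w)%:E).
Proof.
move=> iV mf f01; have mV : measurable_fun setT V by apply/measurable_EFinP;
  case/integrableP: iV.
apply: le_integrable iV => //; first by apply/measurable_EFinP; exact:
  measurable_funM.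
move=> w _ /=; rewrite lee_fin normrM ler_piMr//.
by have /andP[f0 f1] := f01 w; rewrite ger0_norm.
Qed.

(** * The two limits *)

Section limits.
Context (d : measure_display) (T : measurableType d) (R : realType)
  (P : probability T R) (n : nat) (X : T -> n.-tuple R) (Y : R -> T -> n.-tuple
    R)
  (h : R -> n.-tuple R -> R).
Hypothesis mX : measurable_fun setT X.
Hypothesis exX : exchangeable P X.
Hypothesis X2 : forall k : 'I_n, P.-integrable setT (fun w => ((tnth (X w) k) ^+
  2)%:E).
Hypothesis tieX : forall i j : 'I_n, i != j -> P [set w | tnth (X w) i = tnth (X
  w) j] = 0%E.
Hypothesis modelY : forall sigma, 0 < sigma ->
     [/\ measurable_fun setT (Y sigma),
         cond_gaussian P X (Y sigma) sigma &
         cond_prob_version P X (Y sigma) ascending (h sigma)].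

Let g sigma y := h sigma y * (1 - h sigma y).
Let Delta_up sigma := \sum_(pi : 'S_n)
      cond_expect_event P
        (fun w => sqnorm (X w) * g sigma (permvec pi (Y sigma w)))
        (Y sigma @^-1` ascending).
Let iV := integrable_sqnorm X2.

(** Clipping is done separately for each noise level, and the bounded version then enters
    [conditional_sum_unconditional]. *)
Let Delta_upE s : 0 < s -> exists2 h' : n.-tuple R -> R,
  cond_prob_version P X (Y s) ascending h' /\ (forall y, 0 <= h' y <= 1) &
  Delta_up s = n`!%:R * Rintegral P setT
    (fun w => sqnorm (X w) * (h' (Y s w) * (1 - h' (Y s w)))).
Proof.
move=> s0; have [mY XY hP] := modelY s0.
have [h' [N [h'P h'01 mN PN hh']]] := cond_prob_version_clip mX mY
  (@measurable_ascending R n) hP.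
have [mh _] := hP; have [mh' _] := h'P.
exists h' => //; rewrite /Delta_up.
apply: (conditional_sum_unconditional s0 mX mY XY exX X2 (g' := fun y => h' y *
  (1 - h' y)) _ _ _ mN PN).
- by apply: measurable_funM => //; exact: measurable_funB.
- by apply: measurable_funM => //; exact: measurable_funB.
- move=> y; have /andP[h0 h1] := h'01 y.
  by rewrite mulr_ge0 ?subr_ge0//= mulr_ile1 ?subr_ge0// gerBl.
- by move=> y Ny; rewrite /g hh'.
Qed.

Let V0 w : 0 <= sqnorm (X w) := sqnorm_ge0 (X w).

Let nfact_gt0 : 0 < n`!%:R :> R.
Proof. by rewrite ltr0n fact_gt0. Qed.

Lemma Delta_up_small_noise : Delta_up sigma @[sigma --> 0^'+] --> 0.
Proof.
apply/cvgrPdist_le => /= e e0.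
have [mu [iid _]] := exists_iid_normal R n.
(* The tolerance [e / n!] compensates the factor [n!] in [Delta_upE]. *)
have [c c0 small] := integral_small V0 iV (divr_gt0 e0 nfact_gt0).
have /cvgr_le /(_ _ c0) disc := discordant_cvg0 mX tieX mu.
near=> s.
have s0 : 0 < s by near: s; exact: nbhs_right_gt.
have [mY XY _] := modelY s0.
have [h' [h'P h'01] ->] := Delta_upE s0.
have [mh' _] := h'P.
have mhY : measurable_fun setT (fun w => h' (Y s w)) by exact: measurableT_comp
  mh' mY.
have mg : measurable_fun setT (fun w => h' (Y s w) * (1 - h' (Y s w))).
  by apply: measurable_funM => //; exact: measurable_funB.
have g01 w : 0 <= h' (Y s w) * (1 - h' (Y s w)) <= 1.
  have /andP[h0 h1] := h'01 (Y s w).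
  by rewrite mulr_ge0 ?subr_ge0//= mulr_ile1 ?subr_ge0// gerBl.
have mA := @measurable_ascending R n.
have mXA : measurable (X @^-1` ascending).
  by rewrite -[X in measurable X]setTI; exact: mX.
have mYA : measurable (Y s @^-1` ascending).
  by rewrite -[X in measurable X]setTI; exact: mY.
(* Taking [B = ascending] in [cond_var_le] makes the bound the probability of discordance. *)
have Ig : (\int[P]_w (h' (Y s w) * (1 - h' (Y s w)))%:E <= c%:E)%E.
  apply: le_trans (cond_var_le mX mY mA h'P h'01 mA) _.
  rewrite -measureU; last 3 first.
  - by apply: measurableI => //; exact: (measurableC mXA).
  - by apply: measurableI => //; exact: (measurableC mYA).
  - by apply/seteqP; split => w // [[nxA _] [xA _]]; exact: nxA.
  rewrite (_ : _ `|` _ = [set w | discordant (X w, Y s w)]); last first.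
    by apply/seteqP; split => w [[? ?]|[? ?]]; [right|left|right|left].
  rewrite [leLHS](coupling_law s0 mX mY XY iid (@measurable_discordant R n)).
  rewrite -[leLHS]fineK ?lee_fin; first by near: s.
  apply: (fin_num_measure ((P \x mu)%E : probability _ R)).
  rewrite -[X in measurable X]setTI.
  have mc : measurable_fun setT (fun p : T * n.-tuple R => (X p.1, add_scaled (X
    p.1) s p.2)).
    exact: measurable_coupled.
  by apply: mc => //; exact: measurable_discordant.
rewrite sub0r normrN ger0_norm; last first.
  rewrite mulr_ge0 ?(ltW nfact_gt0)// Rintegral_ge0// => w _.
  by rewrite mulr_ge0//; have /andP[] := g01 w.
rewrite mulrC -ler_pdivlMr//.
rewrite -lee_fin /Rintegral fineK; first exact: small.
by apply: integrable_fin_num => //; exact: integrable_mul_unit.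
Unshelve. all: by end_near.
Qed.

Lemma Delta_up_large_noise : Delta_up sigma @[sigma --> +oo] -->
    (Rintegral P setT (fun w => sqnorm (X w)) * (1 - (n`!%:R)^-1) : R).
Proof.
apply/cvgrPdist_le => /= e e0.
have [c c0 small] := integral_small V0 iV (divr_gt0 e0 nfact_gt0).
(* Budget: [shift_const - 1] plus twice the tail is at most [3 * c / 8], below the [eta = c / 2] for
   which [cond_prob_L1] returns [c]. *)
have c8 : 0 < c / 8 by rewrite divr_gt0.
have [M M0 tail] := sqnorm_tail mX iV c8.
have shiftC := shift_const_cvg n M0 c8.
have pE : fine (P (X @^-1` ascending)) = n`!%:R^-1.
  rewrite (ascending_probability mX _ tieX)// => p.
  by rewrite (exX p (@measurable_ascending R n)).
set p := n`!%:R^-1 in pE *.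
have p0 : 0 <= p by rewrite invr_ge0 ltW.
have p1 : p <= 1 by rewrite invf_le1// ler1n fact_gt0.
near=> s.
have s0 : 0 < s by near: s; exact: nbhs_pinfty_gt.
have Cs : shift_const n M s (s + 1) <= 1 + c / 8 by near: s.
have st : s < s + 1 by rewrite ltrDl.
have [mY XY _] := modelY s0.
have [h' [h'P h'01] ->] := Delta_upE s0.
have [mh' _] := h'P.
have mhY : measurable_fun setT (fun w => h' (Y s w)) by exact: measurableT_comp
  mh' mY.
have mg : measurable_fun setT (fun w => h' (Y s w) * (1 - h' (Y s w))).
  by apply: measurable_funM => //; exact: measurable_funB.
have g01 w : 0 <= h' (Y s w) * (1 - h' (Y s w)) <= 1.
  have /andP[h0 h1] := h'01 (Y s w).
  by rewrite mulr_ge0 ?subr_ge0//= mulr_ile1 ?subr_ge0// gerBl.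
pose dist w := `|h' (Y s w) - p|.
have md : measurable_fun setT dist.
  by apply: measurableT_comp => //; exact: measurable_funB.
have dist01 w : 0 <= dist w <= 1.
  have /andP[h0 h1] := h'01 (Y s w).
  by rewrite normr_ge0 ler_norml; apply/andP; split; lra.
have Idist : (\int[P]_w (dist w)%:E <= c%:E)%E.
  rewrite /dist -pE.
  apply: le_trans (cond_prob_L1 (eta := c / 2) mX mY (@measurable_ascending R n)
    h'P h'01 _) _.
    move=> B mB.
    apply: le_trans (joint_nearly_independent mX s0 st M0 mY XY
      (@measurable_ascending R n) mB) _.
    by rewrite lerD2l; lra.
  by rewrite lee_fin; lra.
have iVp : P.-integrable setT (fun w => (sqnorm (X w) * (p * (1 - p)))%:E).
  apply: (integrable_mul_unit (f := cst (p * (1 - p)))) => // w.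
  by rewrite /= mulr_ge0 ?subr_ge0//= mulr_ile1 ?subr_ge0// gerBl.
(* Since [n! * p = 1], the limit [E * (1 - p)] equals [n! * (E * (p * (1 - p)))], where [E] is the
   mean of [sqnorm (X w)]; this puts both terms under one integral. *)
rewrite [X in `|X|](_ : _ = n`!%:R * Rintegral P setT (fun w =>
    sqnorm (X w) * (p * (1 - p)) - sqnorm (X w) * (h' (Y s w) * (1 - h' (Y s
      w))))); last first.
  rewrite RintegralB//; last first.
  - exact: integrable_mul_unit.
  rewrite RintegralZr// (mulrBr n`!%:R); congr (_ - _).
  by rewrite mulrCA (mulrA _ p) divff ?mul1r ?gt_eqF.
rewrite normrM (gtr0_norm nfact_gt0) mulrC -ler_pdivlMr//.
have iB : P.-integrable setT (fun w => (sqnorm (X w) * (p * (1 - p)) -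
    sqnorm (X w) * (h' (Y s w) * (1 - h' (Y s w))))%:E).
  under eq_fun do rewrite EFinB.
  apply: integrableB => //; exact: integrable_mul_unit.
apply: le_trans (le_normr_Rintegral measurableT iB) _.
have iD : P.-integrable setT (fun w => (sqnorm (X w) * dist w)%:E) by exact:
  integrable_mul_unit.
apply: (@le_trans _ _ (Rintegral P setT (fun w => sqnorm (X w) * dist w))).
  apply: le_Rintegral => //.
    by have := integrable_norm iB; apply: eq_integrable.
  move=> w _; rewrite -mulrBr normrM ger0_norm// ler_wpM2l//.
  have /andP[h0 h1] := h'01 (Y s w).
  (* The second factor has absolute value at most [1], as [p] and [h'] lie in [[0, 1]]. *)
  rewrite (_ : _ - _ = (h' (Y s w) - p) * - (1 - p - h' (Y s w))); last by ring.
  rewrite normrM normrN ler_piMr// ler_norml; apply/andP; split; lra.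
rewrite -lee_fin /Rintegral fineK; first exact: small.
exact: integrable_fin_num.
Unshelve. all: by end_near.
Qed.

End limits.

Theorem theorem4 (d : measure_display) (T : measurableType d) (R : realType)
  (P : probability T R) (n : nat)
  (X : T -> n.-tuple R) (Y : R -> T -> n.-tuple R)
  (h : R -> n.-tuple R -> R) :
  measurable_fun setT X ->
  exchangeable P X ->
  (forall k : 'I_n, P.-integrable setT (fun w => ((tnth (X w) k) ^+ 2)%:E)) ->
  (forall i j : 'I_n, i != j -> P [set w | tnth (X w) i = tnth (X w) j] = 0%E) ->
  (forall sigma, 0 < sigma ->
     [/\ measurable_fun setT (Y sigma),
         cond_gaussian P X (Y sigma) sigma &
         cond_prob_version P X (Y sigma) ascending (h sigma)]) ->
  let g sigma y := h sigma y * (1 - h sigma y) in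
  let Delta_up sigma := \sum_(pi : 'S_n)
      cond_expect_event P
        (fun w => sqnorm (X w) * g sigma (permvec pi (Y sigma w)))
        (Y sigma @^-1` ascending) in
  Delta_up sigma @[sigma --> 0^'+] --> 0 /\
  Delta_up sigma @[sigma --> +oo] -->
    (Rintegral P setT (fun w => sqnorm (X w)) * (1 - (n`!%:R)^-1) : R).
Proof.
move=> mX exX X2 tieX modelY g Delta_up; split.
- exact: (Delta_up_small_noise mX exX X2 tieX modelY).
- exact: (Delta_up_large_noise mX exX X2 tieX modelY).
Qed.
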